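(* Let $A=F(X)$ and $B=F(Y)$ be free groups of finite rank, let $C$ be a free group of finite rank embedded in both $A$ and $B$, let $G=A\ast_C B$ be the amalgamated product, and let $S$, $T$ be fixed Schreier transversals of $C$ in $A$ and in $B$. Let $\mathcal{NF}$ be any one of the four sets of normal forms $\mathcal{EF}$ (freely reduced), $\mathcal{RF}$ (reduced), $\mathcal{CNF}$ (canonical), $\mathcal{CRF}$ (cyclically reduced). If $C$ is of infinite index either in $A$ or in $B$, then the set $\mathcal{NF}_{\rm uns}$ of all unstable normal forms and the set $\mathcal{NF}_{\rm sin}$ of all singular normal forms are exponentially $\lambda_{\mathcal{NF}}$-measurable.
   Context: Setting. $C$ is identified with its images in $A$ and $B$ under the given monomorphisms. $F=A\ast B$ is the free group on $X\sqcup Y$; $|\cdot|$ is freely reduced length in $F$ and $S_n$ is the sphere of radius $n$ in $F$. Every nontrivial $f\in F$ is uniquely $f=f_1\cdots f_k$ with syllables $f_i\ne1$ lying alternately in $A$ and $B$. For $A_0\subseteq A$, $B_0\subseteq B$, $A_0\ast B_0\subseteq F$ is the set of all $f$ all of whose syllables lie in $A_0\cup B_0$ (syllables from $A$ in $A_0$, from $B$ in $B_0$), together with $1$ if $1\in A_0\cup B_0$. Transversals. $S$ (resp. $T$) is a Schreier transversal of right cosets of $C$ in $A$ (resp. $B$): a system of right coset representatives, consisting of reduced words, closed under initial segments, with $1$ representing $C$. A representative $s\in S$ is singular if $s\in N_A^*(C)=\{f\in A: f^{-1}Cf\cap C\neq1\}$, and regular otherwise; $s$ is stable if $sc\in S$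 for every $c\in C$, and unstable otherwise. Similarly for $T$ in $B$. An element $g$ of $A$ (or $B$) is regular, singular, stable, unstable if its representative $s$ in the decomposition $g=cs$ ($c\in C$, $s\in S$, resp. $s\in T$) is so. Normal forms, regarded as subsets of $F$: - $\mathcal{EF}=A\ast B$ (freely reduced forms); - $\mathcal{RF}=(A\setminus C)\ast(B\setminus C)$ (nontrivial reduced forms); - $\mathcal{CNF}$: forms $cp_1\cdots p_l$ with $c\in C$, $p_i\in(S\cup T)\setminus\{1\}$ alternating between $S$ and $T$, regarded in $F$ as the set of elements $f_1f_2\cdots f_k$ with $f_1\in (A\cup B)\setminus\{1\}$ arbitrary, $f_i\in (S\cup T)\setminus\{1\}$ for $i\ge2$, syllables alternating between $A$ and $B$, together with $1$; - $\mathcal{CRF}$: elements $f_1\cdots f_k\in\mathcal{RF}$ with $k\geq2$ even; elements of $A\cup B$ not conjugate to an element of $C$ ($k=1$); and elements of $C$ ($k=0$). A normal form $f_1\cdots f_k$ is regular (resp. stable) if at least one of the syllables $f_i$ is regular (resp. stable); otherwise it is singular (resp. unstable). The measure $\lambda_L$. Let $L$ be a regular set of reduced words in $F$ (i.e. accepted by a finite automaton). $\lambda_L$ is defined by the no-return non-stop random walk on a (trim, deterministic) automaton for $L$, starting at the initial state and choosing at each state among the outgoing edges with equal probability: for a reduced word $w=x_1\cdots x_n$ ($x_i$ letters in $X^{\pm1}\cup Y^{\pm1}$) that is a prefix of an element of $L$, $\lambda_L(w)=\prod_{i=0}^{n-1}\frac1{\deg_L(x_1\cdots x_i)}$, where $\deg_L(u)$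 is the number of letters $x$ such that $ux$ is reduced as written and is a prefix of an element of $L$; $\lambda_L(w)=0$ for other $w$. For $R\subseteq F$ put $f'_n(R,L)=\sum_{w\in R\cap S_n}\lambda_L(w)$ and $\lambda_L(R)=\sum_{n\ge0} f'_n(R,L)$. $R$ is exponentially $\lambda_L$-measurable if there is a constant $0<q<1$ with $f'_n(R,L)\le q^n$ for all sufficiently large $n$.
   Formalization: For the cyclically reduced forms with C nontrivial, C is additionally assumed to be a proper subgroup of both A and B; if, say, C = B ≠ 1, the walk stays in B = C with positive probability, where all nontrivial elements are singular and unstable, so the claim fails. *)

(* Defs.v *)
From HB Require Import structures.
From mathcomp Require Import all_boot all_order all_algebra.
From mathcomp Require Import boolp classical_sets functions cardinality fsbigop.
From mathcomp Require Import reals.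

Set Implicit Arguments.
Unset Strict Implicit.
Unset Printing Implicit Defensive.

Import Order.TTheory GRing.Theory Num.Theory.
Local Open Scope classical_set_scope.

(** * Free groups as reduced words *)

(* The pair (x, true) stands for the letter x and (x, false) for x^-1. *)
Notation letter X := (X * bool)%type.

Definition linv X (l : letter X) : letter X := (l.1, ~~ l.2).

Definition reduced (X : eqType) (w : seq (letter X)) : bool :=
  sorted (fun l m => m != linv l) w.

Record freegroup (X : choiceType) := FreeGroup {
  fgword :> seq (letter X);
  fgword_reduced : reduced fgword
}.

HB.instance Definition _ (X : choiceType) := [isSub for @fgword X].
HB.instance Definition _ (X : choiceType) := [Choice of freegroup X by <:].

Definition push (X : eqType) (l : letter X) (w : seq (letter X)) :=
  if w is m :: w' then if m == linv l then w' else l :: w else [:: l].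

Lemma linvK X : involutive (@linv X).
Proof. by case=> x b; rewrite /linv /= negbK. Qed.

Lemma push_reduced (X : eqType) (l : letter X) w : reduced w -> reduced (push l w).
Proof.
case: w => [//|m w] /= rw; case: ifP => [_|/negbT nml].
  by move: rw; rewrite /reduced; case: w => //= ? ? /andP[].
by rewrite /reduced /= nml.
Qed.

Lemma pushK (X : eqType) (l : letter X) w :
  reduced w -> push l (push (linv l) w) = w.
Proof.
case: w => [|m w] /=; first by rewrite eqxx.
rewrite linvK; case: eqVneq => [->|nml] rw; last by rewrite /= eqxx.
case: w rw => [//|m' w] /= /andP[nm'l _].
by rewrite (negbTE nm'l).
Qed.

Lemma foldr_push_reduced (X : eqType) (u v : seq (letter X)) :
  reduced v -> reduced (foldr (@push X) v u).
Proof. by move=> rv; elim: u => //= l u; apply: push_reduced. Qed.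

Lemma foldr_push_push (X : eqType) (l : letter X) v w : reduced w ->
  foldr (@push X) w (push l v) = push l (foldr (@push X) w v).
Proof.
move=> rw; case: v => [//|m v] /=; case: eqP => [->|//].
by rewrite pushK// foldr_push_reduced.
Qed.

Lemma foldr_push_id (X : eqType) (w : seq (letter X)) :
  reduced w -> foldr (@push X) [::] w = w.
Proof.
elim: w => [//|l w IH] rw /=; rewrite IH; last first.
  by move: rw; rewrite /reduced /=; apply: path_sorted.
by case: w rw {IH} => [//|m w] /andP[/negbTE nml _] /=; rewrite nml.
Qed.

Definition winv X (w : seq (letter X)) : seq (letter X) := rev (map (@linv X) w).

Lemma winvK X : involutive (@winv X).
Proof.
by move=> w; rewrite /winv map_rev revK -map_comp -[RHS]map_id; apply/eq_map/linvK.
Qed.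

Lemma winv_reduced (X : eqType) (w : seq (letter X)) :
  reduced w -> reduced (winv w).
Proof.
rewrite /reduced /winv rev_sorted sorted_map; apply: sub_sorted => l m /=.
by apply: contraNneq => ->; rewrite linvK.
Qed.

Lemma foldr_push_winv (X : eqType) (u w : seq (letter X)) : reduced w ->
  foldr (@push X) (foldr (@push X) w u) (winv u) = w.
Proof.
rewrite /winv; elim: u w => [//|l u IH] w rw /=.
rewrite rev_cons -cats1 foldr_cat /= -{2}(linvK l) pushK ?IH//.
exact: foldr_push_reduced.
Qed.

Definition fgone (X : choiceType) : freegroup X := @FreeGroup X [::] isT.

Definition fgmul (X : choiceType) (u v : freegroup X) : freegroup X :=
  FreeGroup (foldr_push_reduced u (fgword_reduced v)).

Definition fginv (X : choiceType) (u : freegroup X) : freegroup X :=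
  FreeGroup (winv_reduced (fgword_reduced u)).

Lemma fgmulA (X : choiceType) : associative (@fgmul X).
Proof.
move=> u v w; apply: val_inj => /=.
elim: (u : seq _) => [//|l u' IH] /=.
by rewrite foldr_push_push ?IH ?fgword_reduced.
Qed.

Lemma fgmul1 (X : choiceType) : left_id (fgone X) (@fgmul X).
Proof. by move=> u; apply: val_inj. Qed.

Lemma fgmulr1 (X : choiceType) : right_id (fgone X) (@fgmul X).
Proof. by move=> u; apply: val_inj; rewrite /= foldr_push_id// fgword_reduced. Qed.

Lemma fgmulV (X : choiceType) : left_inverse (fgone X) (@fginv X) (@fgmul X).
Proof.
move=> u; apply: val_inj => /=.
by rewrite -[X in foldr _ X _](foldr_push_id (fgword_reduced u)) foldr_push_winv.
Qed.

Lemma fgmulrV (X : choiceType) : right_inverse (fgone X) (@fginv X) (@fgmul X).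
Proof.
move=> u; rewrite -{1}[u](_ : fginv (fginv u) = u) ?fgmulV//.
by apply: val_inj; rewrite /= winvK.
Qed.

HB.instance Definition _ (X : choiceType) :=
  isGroup.Build (freegroup X) (@fgmulA X) (@fgmul1 X) (@fgmulr1 X)
    (@fgmulV X) (@fgmulrV X).

(** * Subgroups and transversals *)

Definition rcoset_set (G : groupType) (C : set G) (a : G) : set G :=
  [set (c * a)%g | c in C].

Definition infinite_index (G : groupType) (C : set G) : Prop :=
  infinite_set (range (rcoset_set C)).

(* N_A^*(C) = {f | f^-1 C f meets C nontrivially}; c ^ f is f^-1 c f. *)
Definition nstar (G : groupType) (C : set G) : set G :=
  [set f | [set (c ^ f)%g | c in C] `&` C <> [set 1%g]].

Definition schreier_transversal (X : choiceType)
    (C S : set (freegroup X)) : Prop :=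
  [/\ forall a, exists! s, S s /\ rcoset_set C s a,
      S 1%g &
      forall s u : freegroup X, S s -> prefix u s -> S u].

Definition regular_rep (G : groupType) (C : set G) : set G := ~` nstar C.

Definition stable_rep (G : groupType) (C S : set G) : set G :=
  [set s | forall c, C c -> S (s * c)%g].

(* g has property P when its representative s, given by g = c s, does. *)
Definition by_rep (G : groupType) (C S P : set G) : set G :=
  [set g | exists s, [/\ S s, rcoset_set C s g & P s]].

Definition regular_elt (G : groupType) (C S : set G) : set G :=
  by_rep C S (regular_rep C).

Definition stable_elt (G : groupType) (C S : set G) : set G :=
  by_rep C S (stable_rep C S).

(** * Syllables in the free product F(X) * F(Y) = F(X + Y) *)

Lemma map_reduced (X Y : eqType) (f : X -> Y) (w : seq (letter X)) :
  injective f -> reduced w -> reduced [seq (f l.1, l.2) | l <- w].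
Proof.
move=> f_inj; rewrite /reduced sorted_map; apply: sub_sorted => -[x a] [y b] /=.
by apply: contraNneq; rewrite /linv /= => -[/f_inj-> ->].
Qed.

Lemma inl_inj (X Y : Type) : injective (@inl X Y).
Proof. by move=> ? ? []. Qed.

Lemma inr_inj (X Y : Type) : injective (@inr X Y).
Proof. by move=> ? ? []. Qed.

Definition fginl (X Y : choiceType) (a : freegroup X) : freegroup (X + Y)%type :=
  FreeGroup (map_reduced (@inl_inj X Y) (fgword_reduced a)).

Definition fginr (X Y : choiceType) (b : freegroup Y) : freegroup (X + Y)%type :=
  FreeGroup (map_reduced (@inr_inj X Y) (fgword_reduced b)).

Notation syllable X Y := (freegroup X + freegroup Y)%type.

Definition syl_val (X Y : choiceType) (p : syllable X Y) : freegroup (X + Y)%type :=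
  match p with inl a => fginl Y a | inr b => fginr X b end.

Definition in_factor (X Y : choiceType) (PA : set (freegroup X))
    (PB : set (freegroup Y)) (p : syllable X Y) : Prop :=
  match p with inl a => PA a | inr b => PB b end.

Definition is_inl (A B : Type) (p : A + B) : bool := if p is inl _ then true else false.

(* By unique syllable decomposition, sigma is determined by f: it lists the syllables
   f_1, ..., f_k of f, and is empty for f = 1. *)
Definition syllables (X Y : choiceType) (f : freegroup (X + Y)%type)
    (sigma : seq (syllable X Y)) : Prop :=
  [/\ sorted (fun p q => is_inl p != is_inl q) sigma,
      forall p, p \in sigma -> p <> inl 1%g /\ p <> inr 1%g &
      f = (\prod_(p <- sigma) syl_val p)%g].

Definition star (X Y : choiceType) (A0 : set (freegroup X)) (B0 : set (freegroup Y)) :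
    set (freegroup (X + Y)%type) :=
  [set f | exists sigma, [/\ syllables f sigma,
                             forall p, p \in sigma -> in_factor A0 B0 p &
                             f = 1%g -> A0 1%g \/ B0 1%g]].

(** * The amalgamated product and its normal forms *)

(* The kernel of F(X + Y) -> G: the normal closure of the relators
   phi(c) psi(c)^-1. *)
Inductive amalgam_ker (X Y Z : choiceType) (phi : freegroup Z -> freegroup X)
    (psi : freegroup Z -> freegroup Y) : set (freegroup (X + Y)%type) :=
| amalgam_ker_rel c : amalgam_ker phi psi (fginl Y (phi c) / fginr X (psi c))%g
| amalgam_ker_1 : amalgam_ker phi psi 1%g
| amalgam_ker_div f g : amalgam_ker phi psi f -> amalgam_ker phi psi g ->
    amalgam_ker phi psi (f / g)%g
| amalgam_ker_conj f h : amalgam_ker phi psi f -> amalgam_ker phi psi (f ^ h)%g.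

Definition amalgam_eq (X Y Z : choiceType) (phi : freegroup Z -> freegroup X)
    (psi : freegroup Z -> freegroup Y) (f g : freegroup (X + Y)%type) : Prop :=
  amalgam_ker phi psi (f / g)%g.

(* Conjugacy is taken in G, where phi(c) and psi(c) have the same image. *)
Definition conj_into_C (X Y Z : choiceType) (phi : freegroup Z -> freegroup X)
    (psi : freegroup Z -> freegroup Y) : set (freegroup (X + Y)%type) :=
  [set f | exists c h, amalgam_eq phi psi (f ^ h)%g (fginl Y (phi c))].

Inductive nf_kind := EF | RF | CNF | CRF.

Definition ef_set (X Y : choiceType) : set (freegroup (X + Y)%type) :=
  star [set: freegroup X] [set: freegroup Y].

Definition rf_set (X Y : choiceType) (CA : set (freegroup X))
    (CB : set (freegroup Y)) : set (freegroup (X + Y)%type) :=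
  star (~` CA) (~` CB).

Definition cnf_set (X Y : choiceType) (S : set (freegroup X))
    (T : set (freegroup Y)) : set (freegroup (X + Y)%type) :=
  [set f | exists sigma, syllables f sigma /\
                         forall p, p \in behead sigma -> in_factor S T p].

(* Respectively k >= 2 even, k = 1 and k = 0; an element of C is represented in
   F(X + Y) by both of its images. *)
Definition crf_set (X Y Z : choiceType) (phi : freegroup Z -> freegroup X)
    (psi : freegroup Z -> freegroup Y) : set (freegroup (X + Y)%type) :=
  [set f | rf_set (range phi) (range psi) f /\
           exists sigma, [/\ syllables f sigma, (2 <= size sigma)%N &
                             ~~ odd (size sigma)]]
  `|` (range (@syl_val X Y) `\` conj_into_C phi psi)
  `|` [set f | exists c, f = fginl Y (phi c) \/ f = fginr X (psi c)].

Definition nf_set (X Y Z : choiceType) (phi : freegroup Z -> freegroup X)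
    (psi : freegroup Z -> freegroup Y) (S : set (freegroup X))
    (T : set (freegroup Y)) (k : nf_kind) : set (freegroup (X + Y)%type) :=
  match k with
  | EF => @ef_set X Y
  | RF => rf_set (range phi) (range psi)
  | CNF => cnf_set S T
  | CRF => crf_set phi psi
  end.

Definition some_syllable (X Y : choiceType) (PA : set (freegroup X))
    (PB : set (freegroup Y)) : set (freegroup (X + Y)%type) :=
  [set f | exists sigma, syllables f sigma /\
                         exists p, p \in sigma /\ in_factor PA PB p].

Definition singular_forms (X Y : choiceType) (CA S : set (freegroup X))
    (CB T : set (freegroup Y)) (NF : set (freegroup (X + Y)%type)) :=
  NF `\` some_syllable (regular_elt CA S) (regular_elt CB T).

Definition unstable_forms (X Y : choiceType) (CA S : set (freegroup X))
    (CB T : set (freegroup Y)) (NF : set (freegroup (X + Y)%type)) :=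
  NF `\` some_syllable (stable_elt CA S) (stable_elt CB T).

(** * The measure of a set of reduced words *)

Section Measure.
Local Open Scope ring_scope.

Definition is_prefix_of (X : choiceType) (L : set (freegroup X))
    (w : seq (letter X)) : Prop :=
  exists2 v : freegroup X, L v & prefix w v.

(* A prefix of a reduced word is reduced, so rcons u x is automatically reduced
   as written. *)
Definition deg (X : finType) (L : set (freegroup X)) (u : seq (letter X)) : nat :=
  #|[pred x : letter X | `[< is_prefix_of L (rcons u x) >]]|.

(* The probability that the no-return, non-stop random walk along prefixes of
   elements of L, choosing uniformly among the deg L u continuations of u,
   passes through w. The formula makes sense for every L; no automaton is needed. *)
Definition lambda (K : realType) (X : finType) (L : set (freegroup X))
    (w : freegroup X) : K :=
  if `[< is_prefix_of L w >]
  then \prod_(i < size w) (deg L (take i w))%:R^-1 else 0.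

Definition sphere (X : choiceType) (n : nat) : set (freegroup X) :=
  [set w | size w = n].

Definition frequency (K : realType) (X : finType) (n : nat)
    (R L : set (freegroup X)) : K :=
  \sum_(w \in R `&` @sphere X n) lambda K L w.

Definition exp_measurable (K : realType) (X : finType)
    (R L : set (freegroup X)) : Prop :=
  exists q : K, [/\ 0 < q, q < 1 &
    exists N : nat, forall n, (N <= n)%N -> frequency K n R L <= q ^+ n].
End Measure.

(* Main.v *)
(* Let P be the set of prefixes of elements of C, in the factor where C has infinite index.
   An unstable or singular representative leaves the core of the Schreier graph of C only
   along a path that elements of C can retrace: it is a product u v, without cancellation,
   with u and v^-1 in P, and this form is inherited by all elements c s of the coset. As
   the core is finite and is not the whole graph, every reduced word can be prolonged, by
   boundedly many letters, by a word that is a factor of no element of C; two such words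
   in a row cannot be a factor of any u v as above. Each kind of normal form admits this
   prolongation within boundedly many steps of the random walk, unless the walk dies, so
   each block of boundedly many steps leaves the unstable (singular) forms with
   probability bounded below. *)

Require Import Defs.
From mathcomp Require Import all_boot all_order all_algebra.
From mathcomp Require Import boolp classical_sets functions cardinality fsbigop.
From mathcomp Require Import reals lra zify.

Set Implicit Arguments.
Unset Strict Implicit.
Unset Printing Implicit Defensive.

Import Order.TTheory GRing.Theory Num.Theory.
Local Open Scope classical_set_scope.

(** * Random walks leaving a set *)

(** The delicate case is [CNF]: a syllable after the first must stay in the transversal. Every
    reduced continuation is available only once the syllable is no longer a prefix of an element of
    C; before that its length is bounded, because S meets each coset of the finite core once. Hence,
    if the walk survives long enough after [u], either its last syllable can be prolonged freely, or
    that syllable began after [u] and can be exchanged for a fixed representative. This is why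
    [prefix_recurrent] supposes a surviving [v] but asks only that [w] prolong [u], not [v].

    The escape is built in the first factor; the case of infinite index in the second follows by
    relabelling letters. To make this possible the four kinds of forms enter through bounds on their
    syllable sequences that are symmetric in the factors.

    A trivial C is set apart: the construction of forbidden words uses a letter other than y and its
    inverse, which a free group of rank one lacks. Over a trivial C every syllable is regular and
    stable. *)

Definition prefix_recurrent (X : choiceType) (R L : set (freegroup X)) : Prop :=
  exists k : nat, forall u v, is_prefix_of L v -> prefix u v ->
    size v = (size u + k)%N ->
  exists w, [/\ is_prefix_of L w, prefix u w, (size w <= size u + k)%N &
                ~ is_prefix_of R w].

Lemma is_prefix_of_prefix (X : choiceType) (L : set (freegroup X)) u v :
  prefix u v -> is_prefix_of L v -> is_prefix_of L u.
Proof. by move=> uv [f Lf vf]; exists f => //; apply: prefix_trans vf. Qed.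

Section Analysis.
Local Open Scope ring_scope.
Variables (K : realType) (X : finType) (R L : set (freegroup X)).

Definition word_lambda (w : seq (letter X)) : K :=
  if `[< is_prefix_of L w >]
  then \prod_(i < size w) (deg L (take i w))%:R^-1 else 0.

(** Probability that the walk passes through [u] and, [n] steps later, is still at a prefix of an
    element of [R]. Counting prefixes rather than elements of [R] makes a departure from them
    permanent. *)
Fixpoint prefix_mass (n : nat) (u : seq (letter X)) : K :=
  if n is n'.+1 then \sum_(x : letter X) prefix_mass n' (rcons u x)
  else if `[< is_prefix_of R u >] then word_lambda u else 0.

Lemma word_lambda_ge0 w : 0 <= word_lambda w.
Proof.
rewrite /word_lambda; case: ifP => // _.
by apply: prodr_ge0 => i _; rewrite invr_ge0 ler0n.
Qed.

Lemma word_lambda_rcons u x : is_prefix_of L (rcons u x) ->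
  word_lambda (rcons u x) = word_lambda u * (deg L u)%:R^-1.
Proof.
move=> ux; rewrite /word_lambda !asboolT//; last first.
  by apply: is_prefix_of_prefix ux; apply: prefix_rcons.
rewrite size_rcons big_ord_recr /= -[rcons u x]cats1 take_size_cat//.
by congr (_ * _); apply: eq_bigr => i _; rewrite takel_cat// ltnW.
Qed.

Lemma word_lambda_eq0 u : ~ is_prefix_of L u -> word_lambda u = 0.
Proof. by move=> nu; rewrite /word_lambda asboolF. Qed.

(** Strict inequality occurs only where the walk dies, that is where [deg L u] is 0. *)
Lemma sum_word_lambda_le u :
  \sum_(x : letter X) word_lambda (rcons u x) <= word_lambda u.
Proof.
rewrite (bigID (fun x => `[< is_prefix_of L (rcons u x) >])) /=.
rewrite [X in _ + X]big1 ?addr0; last first.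
  by move=> x /asboolPn nx; apply: word_lambda_eq0.
rewrite (eq_bigr (fun=> word_lambda u * (deg L u)%:R^-1)); last first.
  by move=> x /asboolP; apply: word_lambda_rcons.
rewrite sumr_const -/(deg L u) -mulrnAr -mulr_natr.
case: (deg L u) => [|d]; first by rewrite !mulr0 word_lambda_ge0.
by rewrite mulVf ?mulr1// pnatr_eq0.
Qed.

(** The successor keeps [delta] positive even over an empty alphabet. *)
Let delta : K := #|{: letter X}|.+1%:R^-1.

Let delta_gt0 : 0 < delta. Proof. by rewrite invr_gt0 ltr0n. Qed.

Let delta_ge0 : 0 <= delta. Proof. exact: ltW. Qed.

Let delta_le1 : delta <= 1. Proof. by rewrite invf_le1 ?ltr0n// ler1n. Qed.

Lemma word_lambda_rcons_ge u x : is_prefix_of L (rcons u x) ->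
  delta * word_lambda u <= word_lambda (rcons u x).
Proof.
move=> ux; rewrite word_lambda_rcons// mulrC ler_wpM2l ?word_lambda_ge0//.
have d0 : (0 < deg L u)%N by apply/card_gt0P; exists x; exact/asboolP.
have d1 : (deg L u <= #|{: letter X}|.+1)%N by apply: leqW; exact: max_card.
by rewrite lef_pV2 ?posrE ?ltr0n ?ler_nat.
Qed.

Lemma prefix_mass_le n u : prefix_mass n u <= word_lambda u.
Proof.
elim: n u => [|n IH] u /=; first by case: ifP; rewrite ?word_lambda_ge0.
by apply: le_trans (sum_word_lambda_le u); apply: ler_sum => x _.
Qed.

Lemma prefix_mass_eq0 n u : ~ is_prefix_of R u -> prefix_mass n u = 0.
Proof.
elim: n u => [|n IH] u nu /=; first by rewrite asboolF.
apply: big1 => x _; apply: IH; apply: contra_not nu.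
exact/is_prefix_of_prefix/prefix_rcons.
Qed.

Lemma prefix_mass_no_extension n u :
  (forall v, is_prefix_of L v -> prefix u v -> size v = (size u + n)%N -> False) ->
  prefix_mass n u = 0.
Proof.
elim: n u => [|n IH] u nu /=.
  case: asboolP => // _; apply: word_lambda_eq0 => Lu.
  by apply: (nu u) => //; rewrite ?prefix_refl ?addn0.
apply: big1 => x _; apply: IH => v Lv uxv sv; apply: (nu v) => //.
  by apply: prefix_trans uxv; apply: prefix_rcons.
by rewrite sv size_rcons addSnnS.
Qed.

(** At least the share [delta ^+ size s] of the mass at [u] follows [s] and is lost there for [R];
    all other branches are estimated by their full mass. *)
Lemma prefix_mass_escape n s u :
    is_prefix_of L (u ++ s) -> ~ is_prefix_of R (u ++ s) -> (size s <= n)%N ->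
  prefix_mass n u <= (1 - delta ^+ size s) * word_lambda u.
Proof.
elim: s n u => [|x s IH] n u Lus Rus sn.
  rewrite expr0 subrr mul0r prefix_mass_eq0 => //.
  by rewrite cats0 in Rus.
case: n sn => // n sn /=; rewrite (bigD1 x) //=.
have Lux : is_prefix_of L (rcons u x).
  by apply: is_prefix_of_prefix Lus; rewrite -cat_rcons prefix_prefix.
have IHx := IH n (rcons u x).
rewrite !cat_rcons in IHx; have {}IHx := IHx Lus Rus sn.
apply: le_trans (lerD IHx (ler_sum _ _)) _.
  by move=> y _; exact: prefix_mass_le.
have E := sum_word_lambda_le u; rewrite (bigD1 x) //= in E.
have F : delta ^+ (size s).+1 * word_lambda u <=
         delta ^+ size s * word_lambda (rcons u x).
  by rewrite exprSr -mulrA ler_wpM2l ?exprn_ge0// word_lambda_rcons_ge.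
by rewrite !mulrBl !mul1r; lra.
Qed.

(** A contraction that is uniform in the starting word can be applied at each end point of the first
    [n] steps. *)
Lemma prefix_massD n k u (theta : K) : 0 <= theta ->
    (forall u, prefix_mass k u <= theta * prefix_mass 0 u) ->
  prefix_mass (n + k) u <= theta * prefix_mass n u.
Proof.
move=> theta0 H; elim: n u => [|n IH] u; first exact: H.
by rewrite addSn [prefix_mass _.+1 _]/= mulr_sumr; apply: ler_sum => x _.
Qed.

Lemma prefix_mass_le1 n u : prefix_mass n u <= 1.
Proof.
apply: le_trans (prefix_mass_le n u) _; rewrite /word_lambda.
case: ifP => // _; apply: prodr_ile1 => i _; rewrite invr_ge0 ler0n /=.
case: (deg _ _) => [|d]; first by rewrite invr0.
by rewrite invf_le1 ?ltr0n// ler1n.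
Qed.

Fixpoint words (n : nat) : seq (seq (letter X)) :=
  if n is n'.+1 then [seq x :: w | x <- enum {: letter X}, w <- words n']
  else [:: [::]].

Lemma mem_words n w : (w \in words n) = (size w == n).
Proof.
elim: n w => [|n IH] w; first by rewrite inE size_eq0.
apply/allpairsP/idP => [[[x v]] /= [_ + ->]|]; first by rewrite IH.
case: w => // x w; rewrite eqSS -IH => wn.
by exists (x, w); rewrite mem_enum.
Qed.

Lemma words_uniq n : uniq (words n).
Proof.
elim: n => // n IH; apply: allpairs_uniq; rewrite ?enum_uniq//.
by move=> [x v] [y w] _ _ /= [-> ->].
Qed.

Lemma prefix_massE n u : prefix_mass n u =
  \sum_(w <- words n | `[< is_prefix_of R (u ++ w) >]) word_lambda (u ++ w).
Proof.
rewrite big_mkcond; elim: n u => [|n IH] u.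
  by rewrite big_seq1 cats0.
rewrite [LHS]/= big_flatten big_map big_enum /=; apply: eq_bigr => x _.
by rewrite IH big_map; apply: eq_bigr => w _; rewrite cat_rcons.
Qed.

Lemma frequency_le_prefix_mass n : frequency K n R L <= prefix_mass n [::].
Proof.
pose r : seq (freegroup X) := pmap insub (words n).
have r_uniq : uniq r by apply/pmap_sub_uniq/words_uniq.
have memr w : (w \in r) = (size w == n).
  by rewrite /r mem_pmap_sub mem_words.
rewrite /frequency fsbig_mkcondl.
have -> : @sphere X n = [set` r].
  by apply/seteqP; split=> w /=; rewrite memr /sphere /= => /eqP.
rewrite -fsbig_seq// prefix_massE big_pmap [leRHS]big_mkcond /=.
apply: ler_sum => w _; case: insubP => [f _ fw|_] /=; last first.
  by case: ifP => // _; exact: word_lambda_ge0.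
have lam : lambda K L f = word_lambda w by rewrite /lambda /word_lambda -fw.
rewrite lam; case: ifPn => [/set_mem Rf|_].
  rewrite asboolT//; exists f => //; rewrite -fw; exact: prefix_refl.
by case: ifP => // _; exact: word_lambda_ge0.
Qed.

Lemma bernoulli_le (x : K) n : 0 <= x -> x <= 1 -> 1 - n%:R * x <= (1 - x) ^+ n.
Proof.
move=> x0 x1; elim: n => [|n IH]; first by rewrite mul0r subr0 expr0.
rewrite exprS; apply: le_trans (ler_wpM2l _ IH); last by rewrite subr_ge0.
have nx : 0 <= n%:R * x * x by rewrite !mulr_ge0.
by rewrite -natr1; lra.
Qed.

Lemma prefix_recurrent_exp_measurable : prefix_recurrent R L -> exp_measurable K R L.
Proof.
case=> k0 rec; pose k := k0.+1.
pose eps := delta ^+ k; pose theta := 1 - eps.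
have eps_ge0 : 0 <= eps by exact: exprn_ge0.
have eps_le1 : eps <= 1 by exact: exprn_ile1.
have theta_ge0 : 0 <= theta by rewrite subr_ge0.
have contract u : prefix_mass k u <= theta * prefix_mass 0 u.
  have [Ru|nRu] := pselect (is_prefix_of R u); last first.
    by rewrite !prefix_mass_eq0// mulr0.
  rewrite [X in _ * X]/= asboolT//.
  (* If nothing in [L] prolongs [u] by [k] letters, the walk has died by then and no mass is
     left. *)
  have [|noext] := pselect (exists v, [/\ is_prefix_of L v, prefix u v &
    size v = (size u + k)%N]); last first.
    rewrite prefix_mass_no_extension ?mulr_ge0 ?word_lambda_ge0//.
    by move=> v Lv uv sv; apply: noext; exists v.
  case=> v [Lv uv sv].
  have [] := rec u (take (size u + k0) v).
  - exact: is_prefix_of_prefix (prefix_take _ _) Lv.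
  - case/prefixP: uv => s ->; rewrite take_cat ltnNge leq_addr /=.
    exact: prefix_prefix.
  - by rewrite size_take sv ltn_add2l ltnSn.
  move=> w [Lw /prefixP[s ws] sw Rw]; rewrite ws in Lw Rw sw.
  have sk : (size s <= k)%N by move: sw; rewrite size_cat leq_add2l => /leqW.
  apply: le_trans (prefix_mass_escape Lw Rw sk) _.
  rewrite ler_wpM2r ?word_lambda_ge0// lerB//.
  by rewrite /eps -(subnKC sk) exprD ler_piMr ?exprn_ge0// exprn_ile1.
have geo m j : prefix_mass (j + m * k) [::] <= theta ^+ m.
  elim: m => [|m IH]; first by rewrite expr0 prefix_mass_le1.
  rewrite mulSn [(k + _)%N]addnC addnA exprS.
  apply: le_trans (prefix_massD _ _ theta_ge0 contract) _.
  by rewrite ler_wpM2l.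
(* The mass is at most [theta ^+ (n %/ k)], but no constant factor is allowed in front of [q ^+ n].
   The doubled exponent absorbs the remainder: [q ^+ (k + k)] is at least [theta] by Bernoulli's
   inequality, and [n] is at most [(k + k) * (n %/ k)] as soon as [n] is at least [k]. *)
pose q := 1 - eps / (k + k)%:R.
have kk0 : 0 < (k + k)%:R :> K by rewrite ltr0n addn_gt0.
have eq0 : 0 < eps / (k + k)%:R by rewrite divr_gt0// exprn_gt0.
have eq1 : eps / (k + k)%:R < 1.
  by rewrite ltr_pdivrMr// mul1r (le_lt_trans eps_le1)// ltr1n addnS.
have q0 : 0 < q by rewrite subr_gt0.
have theta_q : theta <= q ^+ (k + k).
  apply: le_trans (bernoulli_le _ (ltW eq0) (ltW eq1)).
  by rewrite mulrC divfK// gt_eqF.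
exists q; split=> //; first by rewrite ltrBlDr ltrDl.
exists k => n kn; apply: le_trans (frequency_le_prefix_mass n) _.
rewrite {1}(divn_eq n k) addnC; apply: le_trans (geo _ _) _.
apply: (@le_trans _ _ ((q ^+ (k + k)) ^+ (n %/ k))).
  by rewrite lerXn2r ?nnegrE ?exprn_ge0// ltW.
rewrite -exprM; apply: ler_wiXn2l; [exact: ltW|by rewrite /q lerBlDr lerDl ltW|].
rewrite mulnDl {1}(divn_eq n k) [(k * _)%N]mulnC leq_add2l.
apply: ltnW (leq_trans (ltn_pmod n (ltn0Sn k0)) _).
by rewrite leq_pmull// divn_gt0.
Qed.
End Analysis.

(** * Cancellation in free groups *)

Section FreeReduction.
Variable X : choiceType.
Implicit Types (u v w : seq (letter X)) (g h : freegroup X).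

Definition fgred w : freegroup X := FreeGroup (foldr_push_reduced w (isT : reduced [::])).

Lemma fgredK w : reduced w -> fgred w = w :> seq _.
Proof. exact: foldr_push_id. Qed.

Lemma fgwordK g : fgred g = g.
Proof. by apply: val_inj; rewrite /= foldr_push_id// fgword_reduced. Qed.

Lemma fgred_cat u v : fgred (u ++ v) = (fgred u * fgred v)%g.
Proof.
apply: val_inj; rewrite /= foldr_cat.
have: reduced (foldr (@push X) [::] v) by exact: foldr_push_reduced.
elim: u (foldr _ _ v) => //= l u IH w rw.
by rewrite foldr_push_push// -IH.
Qed.

Lemma fgred_nil : fgred [::] = 1%g. Proof. exact: val_inj. Qed.

Lemma fgred_inv w : fgred (winv w) = ((fgred w)^-1)%g.
Proof.
apply: (@mulIg _ (fgred w)); rewrite mulVg -fgred_cat; apply: val_inj => /=.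
by rewrite foldr_cat foldr_push_winv.
Qed.

Lemma linv_neq (l : letter X) : l != linv l.
Proof. by case: l => a []; rewrite xpair_eqE andbF. Qed.

Lemma catIr (T : Type) (s t r : seq T) : s ++ r = t ++ r -> s = t.
Proof.
move=> E; have st : size s = size t.
  by apply/eqP; rewrite -(eqn_add2r (size r)) -!size_cat E.
by have := congr1 (take (size s)) E; rewrite take_size_cat// st take_size_cat.
Qed.

Lemma reduced_catl u v : reduced (u ++ v) -> reduced u.
Proof. by move=> /cat_sorted2[]. Qed.

Lemma reduced_catr u v : reduced (u ++ v) -> reduced v.
Proof. by move=> /cat_sorted2[]. Qed.

Lemma reduced_cat_join u w v : u != [::] -> reduced (w ++ u) -> reduced (u ++ v) ->
  reduced (w ++ u ++ v).
Proof.
case: u => // l u _; rewrite /reduced; case: w => // m w /=.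
rewrite !cat_path /= => /andP[-> /andP[-> _]] /=.
by rewrite cat_path.
Qed.

Lemma reduced_cat_last u v d :
  reduced u -> reduced v -> u != [::] -> ohead v != Some (linv (last d u)) ->
  reduced (u ++ v).
Proof.
case: u => // l u ru rv _ /= h; rewrite /reduced /= cat_path.
apply/andP; split; first exact: ru.
case: v rv h => // m v /= ->; rewrite andbT => h.
by apply: contraNneq h => ->.
Qed.

(** Here [f] is the part of [u] that cancels. The later cancellation arguments use this
    factorisation through [fgword_mul]. *)
Lemma foldr_push_split u v : reduced u -> reduced v -> exists e f d,
  [/\ u = e ++ f, v = winv f ++ d & foldr (@push X) v u = e ++ d].
Proof.
move=> + rv; elim: u => [|l u IH] ru; first by exists [::], [::], v.
have [|e [f [d [ue vf uv]]]] := IH; first exact: (@reduced_catr [:: l]).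
rewrite /= uv {}ue in ru *; case: e uv ru => [|m e] uv ru.
  case: d vf uv => [|m d] vf uv; first by exists [:: l], f, [::].
  rewrite /=; case: eqVneq => ml; last by exists [:: l], f, (m :: d).
  exists [::], (l :: f), d; split=> //.
  by rewrite vf /winv /= rev_cons cat_rcons ml.
exists (l :: m :: e), f, d; split=> //=.
by move: ru; rewrite /reduced /= => /andP[/negbTE ->].
Qed.

Lemma fgword_mul g h : exists e f d,
  [/\ fgword g = e ++ f, fgword h = winv f ++ d & fgword (g * h)%g = e ++ d].
Proof. exact: foldr_push_split (fgword_reduced g) (fgword_reduced h). Qed.

Lemma reduced_winv_cat u : reduced (winv u ++ u) -> u = [::].
Proof.
case: u => // l u; rewrite /winv /= rev_cons cat_rcons => /reduced_catr.
by rewrite /reduced /= linvK eqxx.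
Qed.

Lemma winv_cat u v : winv (u ++ v) = winv v ++ winv u.
Proof. by rewrite /winv map_cat rev_cat. Qed.

Lemma size_winv u : size (winv u) = size u.
Proof. by rewrite /winv size_rev size_map. Qed.

(** Either the second half is inverse to the first, so that the word cancels in its middle, or the
    middle letter is its own inverse. *)
Lemma reduced_winv_eq u : reduced u -> winv u = u -> u = [::].
Proof.
move=> ru uE; have [u1 [u2 [E s]]] : exists u1 u2, u = u1 ++ u2 /\
    (size u2 = size u1 \/ size u2 = (size u1).+1).
  exists (take (size u)./2 u), (drop (size u)./2 u); rewrite cat_take_drop.
  split=> //; have := odd_double_half (size u).
  by rewrite size_drop size_take; case: (odd _) => /=; [right|left]; case: ltnP; lia.
move: uE; rewrite E winv_cat; case: s => [s|].
  move=> /eqP; rewrite eqseq_cat ?size_winv// => /andP[/eqP u12 _].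
  by rewrite E -u12 in ru; rewrite -u12 (reduced_winv_cat ru).
case: u2 E => // l u2 _ [s]; rewrite /winv /= rev_cons cat_rcons => /eqP.
rewrite eqseq_cat -/(winv u2) ?size_winv// => /andP[_ /eqP[/(congr1 snd) /=]].
by case: l.2.
Qed.

(** If [e] is no longer than [f], the two factorisations of [g] give [f = k ++ d] with [k] its own
    inverse. So [k] is empty and [g] is [winv d ++ d], which is reduced only when empty. *)
Lemma size_square_gt g : g <> 1%g -> (size g < size (g * g)%g)%N.
Proof.
move=> g1; have [e [f [d [ge gf ->]]]] := fgword_mul g g.
rewrite gf !size_cat size_winv ltn_add2r ltnNge; apply/negP => ef.
apply: g1; pose k := drop (size e) (winv f).
have fE : winv f = e ++ k.
  rewrite -(cat_take_drop (size e) (winv f)) -/k; congr (_ ++ _).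
  have := congr1 (take (size e)) gf.
  by rewrite ge take_size_cat// takel_cat ?size_winv// => ->.
have fkd : f = k ++ d.
  move: gf; rewrite ge fE -catA => /eqP.
  by rewrite eqseq_cat// eqxx => /eqP.
have dk : size (winv d) = size e.
  move: (congr1 size fE); rewrite fkd !size_winv !size_cat; lia.
have k0 : k = [::].
  apply: reduced_winv_eq.
    apply: (@reduced_catl _ d); rewrite -fkd; apply: (@reduced_catr e).
    by rewrite -ge fgword_reduced.
  by move: fE; rewrite fkd winv_cat => /eqP; rewrite eqseq_cat// => /andP[_ /eqP].
have := fgword_reduced g; rewrite gf fkd k0 => /reduced_winv_cat d0.
by apply: val_inj; rewrite /= gf fkd k0 d0.
Qed.

End FreeReduction.

(** * Subgroups, transversals and forbidden factors *)

Section Subgroup.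
Variable X : choiceType.
Implicit Types (u v w : seq (letter X)) (g h : freegroup X).
Implicit Types (C S : set (freegroup X)).

Definition subgroup C := C 1%g /\ forall g h, C g -> C h -> C (g / h)%g.

(** The list [qs] names finitely many vertices of the Schreier graph of [C], in practice a set
    containing its core. *)
Definition coset_in C (qs : seq (freegroup X)) g := exists2 q, q \in qs & C (g / q)%g.

Definition bad_syllable C g := exists u v,
  [/\ fgword g = u ++ v, is_prefix_of C u & is_prefix_of C (winv v)].

Section Basic.
Variable C : set (freegroup X).
Hypothesis Csub : subgroup C.

Lemma subgroup1 : C 1%g. Proof. by case: Csub. Qed.
Lemma subgroupV g : C g -> C (g^-1)%g.
Proof. by move=> Cg; rewrite -div1g; apply: Csub.2 => //; exact: subgroup1. Qed.
Lemma subgroupM g h : C g -> C h -> C (g * h)%g.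
Proof. by move=> Cg /subgroupV Ch; rewrite -(invgK h); exact: Csub.2. Qed.

Lemma rcoset_setE g h : rcoset_set C g h <-> C (h / g)%g.
Proof.
split=> [[c Cc <-]|Chg]; first by rewrite mulgK.
by exists (h / g)%g => //; rewrite mulgVK.
Qed.

Lemma coset_inMl qs c g : C c -> coset_in C qs (c * g)%g <-> coset_in C qs g.
Proof.
move=> Cc; split=> -[q qsq Cq]; exists q => //.
  rewrite -(mulKg c (g / q)%g); apply: subgroupM; first exact: subgroupV.
  by rewrite mulgA.
by rewrite -mulgA; exact: subgroupM.
Qed.

Lemma infinite_index_coset qs : infinite_index C -> exists g, ~ coset_in C qs g.
Proof.
move=> inf; apply: contrapT => /forallNP H; apply: inf.
apply: (@sub_finite_set _ _ (rcoset_set C @` [set` qs])); last first.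
  exact/finite_image/finite_seq.
move=> _ [g _ <-]; have /contrapT[q qsq Cq] := H g; exists q => //.
apply/seteqP; split=> h /rcoset_setE Ch; apply/rcoset_setE.
  rewrite -(divgKA q); apply: subgroupM => //.
  by rewrite -invgF; exact: subgroupV.
by rewrite -(divgKA g); apply: subgroupM.
Qed.

Lemma prefix_coset c : C c -> is_prefix_of C c.
Proof. by move=> Cc; exists c => //; exact: prefix_refl. Qed.

(** If [winv f ++ w ++ r] is an element of [C], its product with [c] is [e ++ w ++ r]. This is
    reduced because the nonempty [w] separates [e] from [r]. *)
Lemma is_prefix_of_mul c e f w : C c -> fgword c = e ++ f ->
  is_prefix_of C (winv f ++ w) -> w != [::] -> reduced (e ++ w) ->
  is_prefix_of C (e ++ w).
Proof.
move=> Cc ce [c' Cc' /prefixP[r c'E]] w0 rew.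
have rwr : reduced (w ++ r).
  by apply: (@reduced_catr _ (winv f)); rewrite catA -c'E fgword_reduced.
have rewr : reduced (e ++ w ++ r) by exact: reduced_cat_join.
exists (c * c')%g; first exact: subgroupM.
have -> : (c * c')%g = fgred (e ++ w ++ r).
  rewrite -(fgwordK c) -(fgwordK c') ce c'E !fgred_cat fgred_inv.
  by rewrite !mulgA mulgK.
by rewrite fgredK// catA prefix_prefix.
Qed.

(** If the cancellation consumes all of [u], the new cut is at the junction of [c] with what is left
    of [v]. If it stops inside [u], the cut stays, and [is_prefix_of_mul] treats the part before
    it. *)
Lemma bad_syllable_mul c g : C c -> bad_syllable C g -> bad_syllable C (c * g)%g.
Proof.
move=> Cc [u [v [guv Pu Pv]]].
have [e [f [d [ce gE cg]]]] := fgword_mul c g.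
have Pe : is_prefix_of C e by exists c => //; rewrite ce prefix_prefix.
rewrite /bad_syllable cg; have [fu|uf] := leqP (size u) (size f).
  exists e, d; split=> //; apply: is_prefix_of_prefix Pv.
  have -> : v = drop (size u) (winv f) ++ d.
    have := congr1 (drop (size u)) gE; rewrite guv drop_size_cat// => ->.
    rewrite drop_cat; case: ltnP => // sf.
    have {}sf : size u = size (winv f).
      by apply/eqP; rewrite eqn_leq sf andbT /winv size_rev size_map.
    by rewrite sf subnn drop0 drop_size.
  by rewrite /winv map_cat rev_cat prefix_prefix.
have uE : u = winv f ++ drop (size f) u.
  rewrite -{1}(cat_take_drop (size f) u); congr (_ ++ _).
  have := congr1 (take (size f)) gE; rewrite guv takel_cat ?(ltnW uf)// => ->.
  by rewrite take_size_cat// /winv size_rev size_map.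
have dE : d = drop (size f) u ++ v.
  have := congr1 (drop (size f)) gE; rewrite guv drop_cat uf => ->.
  by rewrite drop_size_cat// /winv size_rev size_map.
exists (e ++ drop (size f) u), v; split=> //; first by rewrite dE catA.
apply: (is_prefix_of_mul Cc ce); rewrite -?uE//.
  by rewrite -size_eq0 size_drop subn_eq0 -ltnNge.
apply: (@reduced_catl _ _ v); rewrite -catA -dE -cg; exact: fgword_reduced.
Qed.

(** Some nontrivial [d] in [C] has [s * d * s^-1] in [C], and repeated squaring makes [d] longer
    than twice [s]. Then the part of [s] that does not cancel against [d] survives at the start of
    [s * d * s^-1], while the inverse of the part that cancels starts [d]. *)
Lemma nstar_bad s : nstar C s -> bad_syllable C s.
Proof.
move=> sC.
have [d [d1 Cd Cds]] : exists d, [/\ d <> 1%g, C d & C (d ^ s^-1)%g].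
  apply: contrapT => nd; apply: sC; apply/seteqP; split=> [d [[c Cc cs] Cd]|_ ->].
    apply: contrapT => d1; apply: nd; exists d; split=> //.
    by rewrite -cs conjgK.
  split; last exact: subgroup1.
  by exists 1%g; [exact: subgroup1|rewrite conj1g].
have [{d1 Cd Cds}d [Cd Cds sd]] : exists d, [/\ C d, C (d ^ s^-1)%g &
    (size s + size s < size d)%N].
  elim: (_ + _)%N d d1 Cd Cds => [|n IH] d d1 Cd Cds.
    exists d; split=> //; rewrite lt0n size_eq0; apply/eqP => d0.
    by apply: d1; exact: val_inj.
  have [{d1 Cd Cds}d [Cd Cds nd]] := IH d d1 Cd Cds.
  exists (d * d)%g; rewrite conjMg; split; [exact: subgroupM..|].
  have d1 : d <> 1%g by move=> d1; rewrite d1 in nd.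
  exact: leq_ltn_trans nd (size_square_gt d1).
have [e [f [r [se dE sdE]]]] := fgword_mul s d.
have [e' [f' [r' [sdE' siE sdsE]]]] := fgword_mul (s * d)%g s^-1%g.
exists e, f; split=> //; last by exists d => //; rewrite dE prefix_prefix.
exists (d ^ s^-1)%g => //; rewrite conjgE invgK mulgA sdsE.
apply: prefix_catl; rewrite prefixE.
have ee : (size e <= size e')%N.
  have siz : size (winv s) = size (winv f' ++ r') := congr1 size siE.
  have := congr1 size sdE'; have := congr1 size dE; have := congr1 size se.
  by move: siz; rewrite sdE !size_cat !size_winv; lia.
have := congr1 (take (size e)) sdE'; rewrite sdE take_size_cat// takel_cat//.
by move=> <-.
Qed.

Section Transversal.
Variable S : set (freegroup X).
Hypothesis S_transversal : schreier_transversal C S.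

Lemma transversal_inj s t : S s -> S t -> C (s / t)%g -> s = t.
Proof.
case: S_transversal => uS _ _ Ss St Cst.
have [r [_ ru]] := uS s.
rewrite -(ru s) ?(ru t)//; split=> //; apply/rcoset_setE => //.
by rewrite mulgV; exact: subgroup1.
Qed.

(* Off the core the Schreier graph is a forest, so the transversal is forced there. *)
Lemma transversal_extend s d :
  S s -> ~ is_prefix_of C s -> reduced (s ++ d) -> S (fgred (s ++ d)).
Proof.
move=> Ss nPs rsd; case: (S_transversal) => uS _ preS.
have [t [[St /rcoset_setE Ct] _]] := uS (fgred (s ++ d)).
have [e [f [h [ce tE ctE]]]] := fgword_mul (fgred (s ++ d) / t)%g t.
move: ctE; rewrite mulgVK fgredK// => sdE.
have [se|es] := leqP (size s) (size e).
  case: nPs; exists (fgred (s ++ d) / t)%g => //; rewrite ce.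
  apply: prefix_catl; rewrite prefixE.
  by have := congr1 (take (size s)) sdE; rewrite take_size_cat// takel_cat// => <-.
set w := drop (size e) s.
have sE : fgword s = e ++ w.
  rewrite -[LHS](cat_take_drop (size e)); congr (_ ++ _).
  have := congr1 (take (size e)) sdE; rewrite takel_cat ?(ltnW es)// => ->.
  by rewrite take_size_cat.
have hE : h = w ++ d.
  by move: sdE; rewrite sE -catA => /eqP; rewrite eqseq_cat// eqxx => /eqP.
have rfw : reduced (winv f ++ w).
  apply: (@reduced_catl _ _ d); rewrite -catA -hE -tE; exact: fgword_reduced.
(* The representatives [e ++ w] and [winv f ++ w] lie in the same coset, so [e] is [winv f]. The
   element of [C] with word [e ++ f] is then trivial, and [s ++ d] is the representative [t]
   itself. *)
have Sfw : S (fgred (winv f ++ w)).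
  by apply: preS St _; rewrite fgredK// tE hE catA prefix_prefix.
have Csfw : C (s / fgred (winv f ++ w))%g.
  rewrite -(fgwordK s) sE !fgred_cat fgred_inv invgM invgK.
  by rewrite mulgA mulgK -fgred_cat -ce fgwordK.
have := congr1 (@fgword X) (transversal_inj Ss Sfw Csfw).
rewrite sE fgredK// => /catIr eE.
have := fgword_reduced (fgred (s ++ d) / t)%g.
rewrite ce eE => /reduced_winv_cat f0.
by rewrite -catA -hE -tE fgwordK.
Qed.

(** Take [c] with [s * c] outside [S], and split [s] into the part [e] that survives in [s * c] and
    the part that cancels. Were [e] not a prefix of an element of [C], [transversal_extend] applied
    to [e] would put [s * c] into [S]. *)
Lemma unstable_rep_bad s : S s -> ~ stable_rep C S s -> bad_syllable C s.
Proof.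
move=> Ss /existsNP[c /not_implyP[Cc nSsc]].
have [e [f [d [se cE scE]]]] := fgword_mul s c.
exists e, f; split=> //; last by exists c => //; rewrite cE prefix_prefix.
apply: contrapT => nPe; apply: nSsc.
have re : reduced e.
  by apply: (@reduced_catl _ _ f); rewrite -se fgword_reduced.
rewrite -(fgwordK (s * c)%g) scE -(fgredK re).
case: S_transversal => _ _ preS; apply: transversal_extend.
- by apply: preS Ss _; rewrite fgredK// se prefix_prefix.
- by rewrite fgredK.
- by rewrite fgredK// -scE fgword_reduced.
Qed.

End Transversal.
Section Cover.
Variable qs : seq (freegroup X).
Hypothesis qs_prefix : forall u, is_prefix_of C u -> coset_in C qs (fgred u).

(** The representatives in question lie in the cosets of [qs], one in each at most, so there are
    finitely many. *)
Lemma transversal_prefix_bounded S : schreier_transversal C S ->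
  exists n, forall s, S s -> is_prefix_of C s -> (size s <= n)%N.
Proof.
move=> S_transversal; have [uS _ _] := S_transversal.
have [rep repP] := choice uS.
exists (\max_(q <- qs) size (rep q)) => s Ss Ps.
have [q qsq Csq] := qs_prefix Ps; rewrite fgwordK in Csq.
suff -> : s = rep q by apply: leq_bigmax_seq.
have [[Sr /rcoset_setE Cr] _] := repP q.
apply: (transversal_inj S_transversal) => //.
by rewrite -(divgKA q); apply: subgroupM.
Qed.

Lemma transversal_not_prefix S : infinite_index C -> schreier_transversal C S ->
  exists2 s, S s & ~ is_prefix_of C s.
Proof.
move=> /(infinite_index_coset qs)[g gqs] [uS _ _].
have [s [[Ss /rcoset_setE Cgs] _]] := uS g.
exists s => // /qs_prefix; rewrite fgwordK => sqs; apply: gqs.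
by rewrite -(mulgVK s g); apply/coset_inMl.
Qed.

End Cover.

End Basic.

(** If all words not starting with [y] stayed in [qs], two powers of [x] would lead from [q] to the
    same coset, giving a loop [x^N] at [q] with N positive. A word that starts with [y] may be
    preceded by this loop, so it would stay in [qs] as well, against infinite index. *)
Lemma leave_coset C qs q y x : subgroup C -> infinite_index C ->
    x != y -> x != linv y ->
  exists w, [/\ reduced w, ohead w != Some y & ~ coset_in C qs (q * fgred w)%g].
Proof.
move=> Csub inf xy xy'; apply: contrapT => stay.
have {}stay w : reduced w -> ohead w != Some y -> coset_in C qs (q * fgred w)%g.
  by move=> rw wy; apply: contrapT => nw; apply: stay; exists w.
have red_x n w : reduced w -> ohead w != Some (linv x) -> reduced (nseq n x ++ w).
  move=> rw wx; elim: n => [|n IH] //.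
  apply: (@reduced_cat_last _ [:: x] _ x) => //=.
  case: n {IH} => [|n] //=; rewrite (inj_eq Some_inj); exact: linv_neq.
have xn_y n : ohead (nseq n x) != Some y.
  by case: n => //= n; apply: contraNneq xy => -[->].
have rxn n : reduced (nseq n x) by have := red_x n [::] isT isT; rewrite cats0.
have [i [j [ij Cij]]] : exists i j, (i < j)%N /\
    C ((q * fgred (nseq i x)) / (q * fgred (nseq j x)))%g.
  have /choice[f fP] : forall n : 'I_(size qs).+1, exists k : 'I_(size qs),
      C (q * fgred (nseq n x) / nth 1%g qs k)%g.
    move=> n; have [r rq Cr] := stay (nseq n x) (rxn n) (xn_y n).
    have rs : (index r qs < size qs)%N by rewrite index_mem.
    by exists (Ordinal rs); rewrite nth_index.
  have /injectivePn[i [j ij fij]] : ~~ injectiveb f.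
    apply/injectiveP => /leq_card; rewrite !card_ord; lia.
  have Cij : C (q * fgred (nseq i x) / (q * fgred (nseq j x)))%g.
    rewrite -(divgKA (nth 1%g qs (f i))); apply: (subgroupM Csub); first exact: fP.
    by rewrite -invgF; apply: (subgroupV Csub); rewrite fij; exact: fP.
  case: (ltngtP i j) => [?|?|/val_inj/eqP]; last by rewrite (negbTE ij).
    by exists i, j.
  by exists j, i; split => //; rewrite -invgF; apply: (subgroupV Csub).
rewrite -(subnK (ltnW ij)) nseqD fgred_cat mulgA mulgKA in Cij.
set N := (j - i)%N in Cij.
have /(_ Csub)[g gqs] := infinite_index_coset _ qs inf.
apply: gqs; rewrite -(mulVKg q g).
set h := (q^-1 * g)%g; have rh := fgword_reduced h.
have [hy|hy] := eqVneq (ohead h) (Some y); last first.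
  by rewrite -(fgwordK h); exact: stay.
rewrite -[X in coset_in _ _ (X * _)%g](mulgVK (q * fgred (nseq N x))%g q) -mulgA.
apply/(coset_inMl Csub) => //.
rewrite -(fgwordK h) -mulgA -fgred_cat; apply: stay.
  apply: red_x => //; rewrite hy (inj_eq Some_inj).
  by apply: contraNneq xy' => ->; rewrite linvK.
have : (0 < N)%N by rewrite subn_gt0.
by case: N {Cij} => //= N _; apply: contraNneq xy => -[->].
Qed.

Definition forbidden C w := [/\ reduced w, w != [::] &
  forall c, C c -> ~~ infix w c].

(** The word is built by running through [qs], so that from each of its vertices some prefix of the
    word leads out of [qs]. If [a ++ w ++ b] were in [C], all its prefixes would end in [qs], in
    particular [a] and each prolongation of [a] by a prefix of [w]. *)
Lemma forbidden_extension C y : subgroup C -> infinite_index C ->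
    (exists qs, forall u, is_prefix_of C u -> coset_in C qs (fgred u)) ->
    (forall y : letter X, exists2 x, x != y & x != linv y) ->
  exists2 w, forbidden C w & ohead w != Some y.
Proof.
move=> Csub inf [qs qsP] other.
have [w [rw wy wq]] : exists w, [/\ reduced w, ohead w != Some y & forall q,
    q \in qs -> exists2 w', prefix w' w & ~ coset_in C qs (q * fgred w')%g].
  elim: {1}qs => [|q l [w [rw wy IH]]]; first by exists [::].
  (* The excluded letter is the inverse of the last letter of [w]; for empty [w] the default turns
     it into [y]. *)
  have [x xy xy'] := other (linv (last (linv y) w)).
  have [v [rv vy vq]] := leave_coset qs (q * fgred w)%g Csub inf xy xy'.
  exists (w ++ v); split.
  - case: (eqVneq w [::]) => [->//|w0]; exact: (reduced_cat_last rw rv w0 vy).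
  - by case: w {rw IH xy xy' vq} wy vy => //=; rewrite linvK.
  move=> r; rewrite inE => /predU1P[->|/IH[w' w'w ?]].
    by exists (w ++ v); rewrite ?prefix_refl// fgred_cat mulgA.
  by exists w' => //; exact: prefix_catl.
exists w => //.
have nw c : C c -> ~~ infix w c.
  move=> Cc; apply/negP => /infixP[a [b cE]].
  have pre t : prefix t (w ++ b) -> is_prefix_of C (a ++ t).
    by case/prefixP=> t' tE; exists c => //; rewrite cE tE catA prefix_prefix.
  have [] := qsP a; first by rewrite -(cats0 a); apply: pre; rewrite prefix0s.
  move=> q qqs Cq; have [w' w'w] := wq q qqs; apply.
  rewrite -(coset_inMl Csub _ _ Cq) mulgA mulgVK -fgred_cat; apply: qsP; apply: pre.
  exact: prefix_catl.
split=> //; apply: contraTneq (nw _ (subgroup1 Csub)) => ->.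
by rewrite infix0s.
Qed.

(* Two disjoint forbidden factors: the cut of a bad syllable can meet only one of them. *)
Lemma forbidden_cat C w1 w2 g : subgroup C -> forbidden C w1 -> forbidden C w2 ->
  infix (w1 ++ w2) g -> ~ bad_syllable C g.
Proof.
move=> Csub [_ _ n1] [_ _ n2] /infixP[a [b gE]] [u [v [guv [c Cc uc] [c' Cc' vc']]]].
have Cv : infix v (c'^-1)%g.
  case/prefixP: vc' => r c'E; have -> : fgword (c'^-1)%g = winv c' by [].
  by rewrite c'E winv_cat winvK suffixW// suffix_suffix.
have gE' : fgword g = (a ++ w1) ++ w2 ++ b by rewrite gE !catA.
have [au|ua] := leqP (size (a ++ w1)) (size u).
  have := n1 _ Cc; rewrite (infix_trans _ (prefixW uc))//.
  have -> : u = a ++ w1 ++ drop (size (a ++ w1)) u.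
    rewrite catA -{1}(cat_take_drop (size (a ++ w1)) u); congr (_ ++ _).
    have := congr1 (take (size (a ++ w1))) guv.
    by rewrite takel_cat// gE' take_size_cat.
  exact: infix_infix.
have := n2 _ (subgroupV Csub Cc'); rewrite (infix_trans _ Cv)//.
have -> : v = drop (size u) (a ++ w1) ++ w2 ++ b; last exact: infix_infix.
have := congr1 (drop (size u)) guv.
by rewrite drop_size_cat// gE' => <-; rewrite [LHS]drop_cat ua.
Qed.

Lemma subgroup_bad C c : subgroup C -> C c -> bad_syllable C c.
Proof.
move=> Csub Cc; exists c, [::]; rewrite cats0; split=> //; first exact: prefix_coset.
by exists 1%g; [exact: subgroup1|exact: prefix0s].
Qed.

Lemma coset_in_power C t n m : subgroup C -> (0 < n)%N -> C (t ^+ n)%g ->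
  coset_in C [seq t ^+ i | i <- iota 0 n]%g (t ^+ m)%g.
Proof.
move=> Csub n0 Ctn; exists (t ^+ (m %% n))%g.
  by apply/mapP; exists (m %% n)%N => //; rewrite mem_iota ltn_mod.
rewrite -expgnFr ?leq_mod//.
have -> : (m - m %% n = n * (m %/ n))%N by rewrite {1}(divn_eq m n) addnK mulnC.
rewrite expgnA; elim: (m %/ n)%N => [|i IH]; first by rewrite expg0; exact: subgroup1.
by rewrite expgS; exact: subgroupM.
Qed.

(* A nontrivial subgroup of an infinite cyclic group has finite index. *)
Lemma infinite_index_other_letter C (y : letter X) : subgroup C -> infinite_index C ->
  C <> [set 1%g] -> exists2 x, x != y & x != linv y.
Proof.
move=> Csub inf C1; apply: contrapT => none.
pose t := fgred [:: y].
have letters x : x = y \/ x = linv y.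
  by apply: contrapT => /not_orP[/eqP xy /eqP xy']; apply: none; exists x.
have powX n : fgred (nseq n y) = (t ^+ n)%g.
  by elim: n => [|n IH]; rewrite ?fgred_nil ?expg0// expgS -IH -fgred_cat.
have powV n : fgred (nseq n (linv y)) = (t^-1 ^+ n)%g.
  elim: n => [|n IH]; first by rewrite fgred_nil expg0.
  by rewrite expgS -IH -fgred_inv -fgred_cat.
have power g : exists n, g = (t ^+ n)%g \/ g = (t^-1 ^+ n)%g.
  suff [n gn] : exists n, fgword g = nseq n y \/ fgword g = nseq n (linv y).
    exists n; rewrite -powX -powV -(fgwordK g).
    by case: gn => ->; [left|right].
  have := fgword_reduced g; elim: (fgword g) => [|l w IH] rw; first by exists 0%N; left.
  have [n wn] := IH (@reduced_catr _ [:: l] _ rw).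
  case: n => [|n] in wn *.
    have {}wn : w = [::] by case: wn.
    by exists 1%N; rewrite wn; case: (letters l) => ->; [left|right].
  exists n.+2; case: wn rw => -> /andP[] /=.
    by case: (letters l) => [-> _ _|->]; [left|rewrite linvK eqxx].
  by case: (letters l) => [->|-> _ _]; [rewrite eqxx|right].
have [n n0 Ctn] : exists2 n, (0 < n)%N & C (t ^+ n)%g.
  have [c Cc c1] : exists2 c, C c & c <> 1%g.
    apply: contrapT => nc; apply: C1; apply/seteqP; split=> [c Cc|_ ->].
      by apply: contrapT => c1; apply: nc; exists c.
    exact: subgroup1.
  have [n cn] := power c; exists n.
    by rewrite lt0n; apply/eqP => n0; apply: c1; case: cn; rewrite n0.
  case: cn => [<-//|cE]; rewrite -(invgK (t ^+ n)%g) -expVgn -cE.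
  exact: subgroupV.
have Ctn' : C (t^-1 ^+ n)%g by rewrite expVgn; exact: subgroupV.
pose qs := ([seq t ^+ i | i <- iota 0 n] ++ [seq t^-1 ^+ i | i <- iota 0 n])%g.
have [g gqs] := infinite_index_coset Csub qs inf.
have [m [gE|gE]] := power g; apply: gqs; rewrite gE.
  have [q qsq Cq] := coset_in_power m Csub n0 Ctn.
  by exists q => //; rewrite mem_cat qsq.
have [q qsq Cq] := coset_in_power m Csub n0 Ctn'.
by exists q => //; rewrite mem_cat qsq orbT.
Qed.

End Subgroup.

Definition finite_core (X : choiceType) (C : set (freegroup X)) :=
  exists qs, forall u, is_prefix_of C u -> coset_in C qs (fgred u).

(** The bound is uniform since [z], a product of two forbidden words, depends only on the last
    letter of [u]. *)
Lemma escape_word (X : finType) (C : set (freegroup X)) :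
    subgroup C -> infinite_index C -> C <> [set 1%g] -> finite_core C ->
  exists k, forall u : seq (letter X), reduced u -> exists z : seq (letter X),
    [/\ reduced (u ++ z), z != [::], (size z <= k)%N &
        forall g : freegroup X, infix z g -> ~ bad_syllable C g].
Proof.
move=> Csub inf C1 core.
have ext (y : letter X) := forbidden_extension y Csub inf core
  (fun y : letter X => infinite_index_other_letter y Csub inf C1).
have zP (y : letter X) : exists z : seq (letter X),
    [/\ reduced z, z != [::], ohead z != Some y &
     forall g : freegroup X, infix z g -> ~ bad_syllable C g].
  have [w1 f1 w1y] := ext y; have [rw1 w10 _] := f1.
  have [w2 f2 w2y] := ext (linv (last y w1)); have [rw2 w20 _] := f2.
  exists (w1 ++ w2); split.
  - exact: (reduced_cat_last rw1 rw2 w10 w2y).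
  - by case: w1 w10 {w1y f1 rw1 w2y}.
  - by case: w1 w10 w1y {f1 rw1 w2y}.
  - by move=> g; exact: forbidden_cat.
have [z zE] := choice zP.
exists (\max_y size (z y)) => u ru.
have [d] : exists d : letter X, True.
  apply: contrapT => nd; apply: C1; apply/seteqP.
  split=> [c Cc|_ ->]; last exact: subgroup1.
  case cE: (fgword c) => [|d w]; last by case: nd; exists d.
  by apply: val_inj; rewrite /= cE.
move=> _; have [rz z0 zy zbad] := zE (linv (last d u)).
exists (z (linv (last d u))); split=> //.
  have [u0|u0] := eqVneq u [::]; first by rewrite {1}u0.
  exact: (reduced_cat_last ru rz u0 zy).
exact: leq_bigmax.
Qed.

(** * Finiteness of the core for a finitely generated subgroup *)

Section FiniteRank.
Variables (X : choiceType) (Z : finType).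
Variable phi : {multiplicative freegroup Z -> freegroup X}.

Lemma multiplicative1 : phi 1%g = 1%g.
Proof. by apply: (@mulgI _ (phi 1%g)); rewrite -gmulfM !mulg1. Qed.

Lemma range_subgroup : subgroup (range phi).
Proof.
split=> [|_ _ [g _ <-] [h _ <-]]; first by exists 1%g => //; exact: multiplicative1.
exists (g / h)%g => //; apply: (@mulIg _ (phi h)).
by rewrite -gmulfM !mulgVK.
Qed.

(** The prefixes of the images of single letters cover the core. Indeed a prefix of the image of
    [l :: w] is a prefix of the image of [l], or that image times a prefix of the image of [w]; left
    multiplication by an element of the subgroup keeps the right coset. *)
Lemma range_finite_core : finite_core (range phi).
Proof.
have Csub := range_subgroup.
pose pref (w : seq (letter X)) := [seq fgred (take i w) | i <- iota 0 (size w).+1].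
have mem_pref u w : prefix u w -> fgred u \in pref w.
  move=> /[dup] /size_prefix s; rewrite prefixE => /eqP <-.
  by apply/mapP; exists (size u) => //; rewrite mem_iota.
pose qs := 1%g :: flatten [seq pref (phi (fgred [:: l])) | l <- enum {: letter Z}].
exists qs => u [_ [g _ <-]]; rewrite -(fgwordK g).
elim: (fgword g) u => [|l w IH] u.
  rewrite fgred_nil multiplicative1 => u1.
  have /eqP -> : u == [::] by rewrite -prefixs0.
  exists 1%g; first by rewrite inE eqxx.
  by rewrite divg1 fgred_nil; exact: subgroup1.
rewrite -cat1s fgred_cat gmulfM; set a := phi _.
have [e [f [d [aE bE ->]]]] := fgword_mul a (phi (fgred w)).
have inqs v : prefix v a -> coset_in (range phi) qs (fgred v).
  move=> va; exists (fgred v); last by rewrite mulgV; exact: subgroup1.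
  rewrite inE; apply/orP; right; apply/flattenP; exists (pref a); last exact: mem_pref.
  by apply/mapP; exists l; rewrite ?mem_enum.
have [ue|eu] := leqP (size u) (size e) => /prefixP[r uE].
  apply: inqs; rewrite aE prefix_catl// prefixE.
  by rewrite -(takel_cat d)// uE take_size_cat.
set u' := drop (size e) u.
have uE' : u = e ++ u'.
  rewrite -(cat_take_drop (size e) u); congr (_ ++ _).
  by rewrite -(takel_cat r) ?(ltnW eu)// -uE take_size_cat.
have -> : fgred u = (a * fgred (winv f ++ u'))%g.
  by rewrite -(fgwordK a) aE uE' !fgred_cat fgred_inv mulgA mulgK.
apply/(coset_inMl Csub); first by exists (fgred [:: l]).
apply: IH; rewrite bE; apply/prefixP; exists r.
rewrite -catA; congr (_ ++ _).
by move: uE; rewrite uE' -catA => /eqP; rewrite eqseq_cat// eqxx => /eqP.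
Qed.

End FiniteRank.

(** * Syllable decompositions *)

Section Syllables.
Variables X Y : choiceType.
Implicit Types (p q : syllable X Y) (sigma tau : seq (syllable X Y)).
Implicit Types (u v : seq (letter (X + Y)%type)).

Definition left_word (w : seq (letter X)) : seq (letter (X + Y)%type) :=
  [seq (inl l.1, l.2) | l <- w].

Definition syl_word sigma : seq (letter (X + Y)%type) :=
  flatten [seq fgword (syl_val p) | p <- sigma].

Definition nontrivial p := p <> inl 1%g /\ p <> inr 1%g.

Definition alternating sigma :=
  sorted (fun p q => is_inl p != is_inl q) sigma /\
  forall p, p \in sigma -> nontrivial p.

Definition syl_prefix p q : Prop :=
  match p, q with
  | inl a, inl b => prefix a b
  | inr a, inr b => prefix a b
  | _, _ => False
  end.

Lemma syl_val_side p l : l \in fgword (syl_val p) -> is_inl l.1 = is_inl p.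
Proof. by case: p => a /= /mapP[m _ ->]. Qed.

Lemma syl_val_nil p : nontrivial p -> fgword (syl_val p) != [::].
Proof.
case: p => a [na na']; rewrite -size_eq0 /= size_map size_eq0; apply/eqP => a0.
  by apply: na; congr inl; apply: val_inj.
by apply: na'; congr inr; apply: val_inj.
Qed.

Lemma alternating_behead p sigma : alternating (p :: sigma) -> alternating sigma.
Proof.
case=> /path_sorted s nt; split=> // q qs; apply: nt; by rewrite inE qs orbT.
Qed.

Lemma alternating_nontrivial p sigma : alternating (p :: sigma) -> nontrivial p.
Proof. by case=> _; apply; rewrite inE eqxx. Qed.

Lemma alternating_head p sigma l : alternating (p :: sigma) ->
  ohead (syl_word sigma) = Some l -> is_inl l.1 != is_inl p.
Proof.
case: sigma => // q sigma [/andP[pq _] nt].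
have /syl_val_nil : nontrivial q by apply: nt; rewrite !inE eqxx orbT.
rewrite /syl_word /=; case qE: (fgword _) => [//|m w] _ /= [<-].
by rewrite (@syl_val_side q) ?qE ?inE ?eqxx// eq_sym.
Qed.

Lemma reduced_syl_word sigma : alternating sigma -> reduced (syl_word sigma).
Proof.
elim: sigma => // p sigma IH alt.
have nt := syl_val_nil (alternating_nontrivial alt).
have rs := IH (alternating_behead alt).
rewrite /syl_word /= -/(syl_word sigma).
case pE: (fgword (syl_val p)) nt => [//|l w] _.
apply: (@reduced_cat_last _ _ _ l) => //; first by rewrite -pE fgword_reduced.
case hE: (ohead _) => [m|//]; have := alternating_head alt hE.
apply: contraNneq => -[->] /=; rewrite (@syl_val_side p (last l (l :: w)))//.
by rewrite pE /= mem_last.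
Qed.

Lemma fgred_syl_word sigma :
  fgred (syl_word sigma) = (\prod_(p <- sigma) syl_val p)%g.
Proof.
elim: sigma => [|p sigma IH]; first by rewrite big_nil; exact: val_inj.
by rewrite big_cons -IH /syl_word /= fgred_cat fgwordK.
Qed.

Lemma syllablesE (f : freegroup (X + Y)%type) sigma : syllables f sigma <->
  alternating sigma /\ fgword f = syl_word sigma.
Proof.
split=> [[s nt ->]|[[s nt] fE]].
  split=> //; rewrite -fgred_syl_word fgredK//; exact: reduced_syl_word.
by split=> //; rewrite -fgred_syl_word -fE fgwordK.
Qed.

Lemma syllables_fgred sigma : alternating sigma ->
  syllables (fgred (syl_word sigma)) sigma.
Proof.
by move=> alt; apply/syllablesE; rewrite fgredK//; exact: reduced_syl_word.
Qed.

Lemma syl_word_rcons sigma p :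
  syl_word (rcons sigma p) = syl_word sigma ++ fgword (syl_val p).
Proof. by rewrite /syl_word map_rcons flatten_rcons. Qed.

Lemma syl_word_prefix sigma u : alternating sigma -> u != [::] ->
    prefix u (syl_word sigma) ->
  exists sigma1 p q sigma2, [/\ sigma = sigma1 ++ p :: sigma2, syl_prefix q p,
    nontrivial q & u = syl_word (rcons sigma1 q)].
Proof.
elim: sigma u => [|p sigma IH] u alt u0.
  by rewrite prefixs0 (negbTE u0).
rewrite /syl_word /= -/(syl_word sigma) => pu.
have [up|pu'] := leqP (size u) (size (syl_val p)).
  have {}pu : u = take (size u) (fgword (syl_val p)).
    by move: pu; rewrite prefixE takel_cat// => /eqP.
  exists [::], p; rewrite /syl_word /=.
  suff [q [qp qu]] : exists q, syl_prefix q p /\ u = fgword (syl_val q).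
    exists q, sigma; split=> //; last by rewrite cats0.
    by split=> qE; move: u0; rewrite qu qE.
  case: p up pu {alt} => a /= up ->; rewrite -map_take; set t := take _ _.
    exists (inl (fgred t)); have tE : fgred t = t :> seq _.
      by rewrite fgredK// /reduced; apply: take_sorted; exact: fgword_reduced.
    by split; [rewrite /syl_prefix tE prefix_take|rewrite -{1}tE].
  exists (inr (fgred t)); have tE : fgred t = t :> seq _.
    by rewrite fgredK// /reduced; apply: take_sorted; exact: fgword_reduced.
  by split; [rewrite /syl_prefix tE prefix_take|rewrite -{1}tE].
have [r uE] : exists r, u = fgword (syl_val p) ++ r.
  exists (drop (size (syl_val p)) u); rewrite -{1}(cat_take_drop (size (syl_val p)) u).
  congr (_ ++ _); case/prefixP: pu => s E.
  by rewrite -(takel_cat s) ?(ltnW pu')// -E take_size_cat.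
have r0 : r != [::].
  by apply: contraTneq pu' => r0; rewrite uE r0 cats0 ltnn.
move: pu; rewrite uE prefix_catr// eqxx /= => pr.
have [s1 [q [q' [s2 [-> qq' ntq' ->]]]]] := IH _ (alternating_behead alt) r0 pr.
by exists (p :: s1), q, q', s2; split.
Qed.

(** Adjacent syllables use letters of different factors, so a block of letters of [X] cannot
    straddle two of them. *)
Lemma infix_left_word sigma z : alternating sigma -> z != [::] ->
  infix (left_word z) (syl_word sigma) -> exists2 a, inl a \in sigma & infix z a.
Proof.
move=> alt z0; elim: sigma alt => [_|p sigma IH alt].
  by rewrite infixs0 -size_eq0 size_map size_eq0 (negbTE z0).
rewrite /syl_word /= -/(syl_word sigma) => /infixP[a [b E]].
have [pa|ap] := leqP (size (syl_val p)) (size a).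
  have [|c cs zc] := IH (alternating_behead alt).
    apply/infixP; exists (drop (size (syl_val p)) a), b.
    have -> : syl_word sigma = drop (size (syl_val p)) (a ++ left_word z ++ b).
      by rewrite -E drop_size_cat.
    rewrite drop_cat; case: ltnP => // ap.
    have pE : size (syl_val p) = size a by apply/eqP; rewrite eqn_leq pa.
    by rewrite pE subnn drop0 drop_size.
  by exists c => //; rewrite inE cs orbT.
have [p2 pE] : exists p2 : seq (letter (X + Y)%type), fgword (syl_val p) = a ++ p2.
  exists (drop (size a) (syl_val p)).
  rewrite -{1}(cat_take_drop (size a) (syl_val p)); congr (_ ++ _).
  by rewrite -(takel_cat (syl_word sigma)) ?(ltnW ap)// E take_size_cat.
have {}E : p2 ++ syl_word sigma = left_word z ++ b.
  by move: E; rewrite pE -catA => /eqP; rewrite eqseq_cat// eqxx => /eqP.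
have p20 : p2 != [::] by apply: contraTneq ap => p20; rewrite pE p20 cats0 ltnn.
have side l : l \in p2 -> is_inl l.1 = is_inl p.
  by move=> lp2; apply: syl_val_side; rewrite pE mem_cat lp2 orbT.
have pl : is_inl p.
  case: p2 p20 E side {pE} => // l p2 _; case: z z0 {IH} => // m z _ [-> _].
  by move/(_ _ (mem_head _ _)) <-.
have [zp|pz] := leqP (size z) (size p2).
  case: p pE pl {ap alt side} => // c pE _; exists c; first exact: mem_head.
  have lzE : left_word z = take (size z) p2.
    by rewrite -(takel_cat (syl_word sigma))// E take_size_cat ?size_map.
  apply/infixP; exists (take (size a) c), (drop (size a + size z) c).
  have cE : left_word c = a ++ left_word z ++ drop (size z) p2.
    by rewrite lzE cat_take_drop.
  have lz : left_word z = left_word (take (size z) (drop (size a) c)).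
    rewrite /left_word map_take map_drop -/(left_word c) cE drop_size_cat//.
    by rewrite take_size_cat// size_map.
  have l_inj : injective (fun l : letter X => (inl l.1, l.2) : letter (X + Y)%type).
    by move=> [x1 b1] [x2 b2] /= [-> ->].
  have {lz} zE := inj_map l_inj lz.
  by rewrite {1}zE addnC -drop_drop !cat_take_drop.
have [l [r lE]] : exists l r, drop (size p2) (left_word z) = l :: r.
  case lE: (drop _ _) => [|l r]; last by exists l, r.
  by move/(congr1 size)/eqP: lE; rewrite size_drop size_map subn_eq0 leqNgt pz.
have hE : ohead (syl_word sigma) = Some l.
  have -> : syl_word sigma = drop (size p2) (left_word z ++ b).
    by rewrite -E drop_size_cat.
  by rewrite drop_cat size_map pz lE.
have := alternating_head alt hE; rewrite pl.
have : l \in left_word z by apply: (@mem_drop (size p2)); rewrite lE mem_head.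
by case/mapP=> m _ ->.
Qed.

Lemma alternating_rcons sigma p q : alternating (rcons sigma p) -> nontrivial q ->
  is_inl q != is_inl p -> alternating (rcons (rcons sigma p) q).
Proof.
case=> s nt ntq qp; split.
  case: sigma s {nt} => [_|r sigma] /=; first by rewrite eq_sym qp.
  by move=> s; rewrite rcons_path s last_rcons eq_sym.
by move=> r; rewrite mem_rcons inE => /predU1P[->//|/nt].
Qed.

Lemma alternating_last sigma p q : alternating (rcons sigma p) -> nontrivial q ->
  is_inl q = is_inl p -> alternating (rcons sigma q).
Proof.
case=> s nt ntq qp; split.
  case: sigma s {nt} => [//|r sigma] /=.
  by rewrite !rcons_path qp.
move=> r; rewrite mem_rcons inE => /predU1P[->//|rs].
by apply: nt; rewrite mem_rcons inE rs orbT.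
Qed.

Lemma alternating_catl sigma tau : alternating (sigma ++ tau) -> alternating sigma.
Proof.
by case=> /cat_sorted2[s _] nt; split=> // r rs; apply: nt; rewrite mem_cat rs.
Qed.

Lemma alternating1 p : nontrivial p -> alternating [:: p].
Proof. by move=> nt; split=> // q; rewrite inE => /eqP ->. Qed.

Lemma nontrivial_inl (a : freegroup X) : fgword a != [::] -> nontrivial (inl a).
Proof. by move=> a0; split=> // -[aE]; rewrite aE in a0. Qed.

Lemma nontrivial_inr (b : freegroup Y) : fgword b != [::] -> nontrivial (inr b).
Proof. by move=> b0; split=> // -[bE]; rewrite bE in b0. Qed.

(** Here [p] is the syllable in which [u] ends and [q] the part of it already read. The constraint
    [P] bears on [p], and has to be restored when [q] is completed differently. *)
Lemma is_prefix_of_syllables (L : set (freegroup (X + Y)%type))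
    (P : seq (syllable X Y) -> Prop) u :
  (forall f, L f -> exists2 sigma, syllables f sigma & P sigma) ->
  is_prefix_of L u -> u != [::] -> exists sigma1 p q sigma2,
    [/\ P (sigma1 ++ p :: sigma2), alternating (rcons sigma1 p), syl_prefix q p,
        alternating (rcons sigma1 q) & u = syl_word (rcons sigma1 q)].
Proof.
move=> LP [f /LP[sigma /syllablesE[alt fE] Ps] uf] u0.
rewrite fE in uf; have [s1 [p [q [s2 [sE qp ntq uE]]]]] := syl_word_prefix alt u0 uf.
have altp : alternating (rcons s1 p).
  by apply: (@alternating_catl _ s2); rewrite cat_rcons -sE.
exists s1, p, q, s2; split=> //; first by rewrite -sE.
apply: alternating_last altp _ _ => //.
by case: p qp {sE} => [?|?]; case: q {uE ntq}.
Qed.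

End Syllables.

(** * Prolongation of normal forms *)

Section LeftRecurrent.
Variables X Y : choiceType.
Variables (C : set (freegroup X)) (R : set (freegroup (X + Y)%type)).
Hypothesis R_bad : forall f, R f -> exists2 sigma, syllables f sigma &
  forall a, inl a \in sigma -> bad_syllable C a.

Definition escaping (z : seq (letter X)) :=
  z != [::] /\ forall g : freegroup X, infix z g -> ~ bad_syllable C g.

Lemma escaping_not_prefix z w : escaping z -> infix (left_word Y z) w ->
  ~ is_prefix_of R w.
Proof.
move=> [z0 zbad] zw [f /R_bad[sigma /syllablesE[alt fE] bad] wf].
have zf : infix (left_word Y z) (syl_word sigma).
  by rewrite -fE; apply: infix_trans zw (prefixW wf).
have [a /bad abad za] := infix_left_word alt z0 zf.
exact: zbad za abad.
Qed.

(** Suits the kinds of forms in which every prefix has an escape, whether or not the walk survives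
    from it. *)
Lemma prefix_recurrent_of_escape (L : set (freegroup (X + Y)%type)) k :
  (forall u, is_prefix_of L u -> exists w z, [/\ is_prefix_of L w, prefix u w,
     (size w <= size u + k)%N, escaping z & infix (left_word Y z) w]) ->
  prefix_recurrent R L.
Proof.
move=> H; exists k => u v Lv uv _.
have [w [z [Lw uw sw escz zw]]] := H u (is_prefix_of_prefix uv Lv).
by exists w; split=> //; exact: escaping_not_prefix zw.
Qed.

Variable k : nat.
Hypothesis escape : forall u : seq (letter X), reduced u -> exists z,
  [/\ reduced (u ++ z), (size z <= k)%N & escaping z].

Lemma left_extension sigma a : alternating (rcons sigma (inl a : syllable X Y)) ->
  exists b z, [/\ alternating (rcons sigma (inl b : syllable X Y)), escaping z,
    infix z b, fgword b = a ++ z & (size z <= k)%N].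
Proof.
move=> alt; have [z [raz zk escz]] := escape (fgword_reduced a).
exists (fgred (a ++ z)), z; rewrite fgredK//; split=> //; last exact: suffix_infix.
apply: alternating_last alt _ _ => //; apply: nontrivial_inl; rewrite fgredK//.
by case: escz => + _; case: (fgword a); case: z {raz zk}.
Qed.

Lemma left_letters : exists b z, [/\ nontrivial (inl b : syllable X Y), escaping z,
    infix z b & (size b <= k)%N].
Proof.
have [z [rz zk escz]] := @escape [::] isT; exists (fgred z), z.
have rz' : reduced z by [].
rewrite fgredK ?infix_refl//; split=> //; apply: nontrivial_inl; rewrite fgredK//.
by case: escz.
Qed.

Lemma infix_syl_word sigma (a : freegroup X) (z : seq (letter X)) :
  inl a \in sigma -> infix z a -> infix (left_word Y z) (@syl_word X Y sigma).
Proof.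
move=> /splitPr[s1 s2] /infixP[t1 [t2 aE]].
apply/infixP; exists (syl_word s1 ++ left_word Y t1), (left_word Y t2 ++ syl_word s2).
rewrite /syl_word map_cat flatten_cat /= aE /left_word.
by rewrite !map_cat -!catA.
Qed.

Lemma syl_word_rcons_prefix sigma (p q : syllable X Y) : syl_prefix p q ->
  prefix (syl_word (rcons sigma p)) (syl_word (rcons sigma q)).
Proof.
move=> pq; rewrite !syl_word_rcons prefix_catr// eqxx /=.
by case: p q pq => [a|a] [b|b] //= /prefixP[r ->]; rewrite map_cat prefix_prefix.
Qed.

Lemma size_syl_word_rcons sigma (p : syllable X Y) :
  size (syl_word (rcons sigma p)) = (size (syl_word sigma) + size (syl_val p))%N.
Proof. by rewrite syl_word_rcons size_cat. Qed.

Lemma size_syl_val (p : syllable X Y) :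
  size (syl_val p) = match p with inl a => size a | inr b => size b end.
Proof. by case: p => a /=; rewrite size_map. Qed.

(** Of the [k.+2] letters, one brings an unfinished syllable of the second factor into [DB], [k] are
    for the escaping word, and one is for a last syllable that makes their number even. A syllable
    of the first factor lies in [DA] as soon as it contains an escaping word. *)
Lemma recurrent_even (DA : set (freegroup X)) (DB : set (freegroup Y))
    (L : set (freegroup (X + Y)%type)) :
  (forall f, L f -> exists2 sigma, syllables f sigma &
     (forall p, p \in sigma -> in_factor DA DB p) \/ (size sigma <= 1)%N) ->
  (forall f sigma, syllables f sigma -> (2 <= size sigma)%N -> ~~ odd (size sigma) ->
     (forall p, p \in sigma -> in_factor DA DB p) -> L f) ->
  (forall z g, escaping z -> infix z (fgword g) -> DA g) ->
  (forall b : freegroup Y, exists b' : freegroup Y, [/\ prefix b b',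
     (size b' <= (size b).+1)%N, DB b' & fgword b' != [::]]) ->
  prefix_recurrent R L.
Proof.
move=> up low hA hB; apply: (@prefix_recurrent_of_escape _ k.+2) => u Lu.
have [sigma [a [z [alt escz za fac [us su]]]]] : exists sigma a z,
    [/\ alternating (rcons sigma (inl a : syllable X Y)), escaping z, infix z (fgword a),
        forall p, p \in rcons sigma (inl a) -> in_factor DA DB p &
        prefix u (syl_word (rcons sigma (inl a)))
        /\ (size (syl_word (rcons sigma (inl a))) <= size u + k.+1)%N].
  have [->|u0] := eqVneq u [::].
    have [a [z [nta escz za ak]]] := left_letters.
    exists [::], a, z; split=> //; first exact: alternating1.
      by move=> p; rewrite inE => /eqP ->; exact: hA za.
    by rewrite prefix0s size_syl_word_rcons size_syl_val /=; split=> //; lia.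
  have [s1 [p [q [s2 [fac altp qp alt ->]]]]] := is_prefix_of_syllables up Lu u0.
  have {}fac r : r \in s1 -> in_factor DA DB r.
    case: fac => [fac rs1|]; first by apply: fac; rewrite mem_cat rs1.
    by case: s1 {altp alt} => //= ? ?; rewrite size_cat /= addnS.
  case: q qp alt => [a|b] qp alt.
    have [b [z [altb escz zb bE zk]]] := left_extension alt.
    exists s1, b, z; split=> //.
      move=> r; rewrite mem_rcons inE => /predU1P[->|/fac//].
      exact: hA escz zb.
    split; first by apply: syl_word_rcons_prefix; rewrite /= bE prefix_prefix.
    by rewrite !size_syl_word_rcons !size_syl_val bE size_cat; lia.
  have [b' [bb' sb' DBb' b'0]] := hB b.
  have [a [z [nta escz za ak]]] := left_letters.
  exists (rcons s1 (inr b')), a, z; split=> //.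
  - apply: alternating_rcons => //.
    by apply: (alternating_last alt) => //; exact: nontrivial_inr.
  - move=> r; rewrite mem_rcons inE => /predU1P[->|]; first exact: hA escz za.
    by rewrite mem_rcons inE => /predU1P[->|/fac].
  - split.
      rewrite (syl_word_rcons (rcons _ _)); apply: prefix_catl.
      exact: syl_word_rcons_prefix.
    by rewrite !size_syl_word_rcons !size_syl_val; lia.
have ina : inl a \in rcons sigma (inl a : syllable X Y).
  by rewrite mem_rcons mem_head.
have fin tau : alternating tau -> (2 <= size tau)%N -> ~~ odd (size tau) ->
    (forall p, p \in tau -> in_factor DA DB p) -> inl a \in tau ->
    prefix u (syl_word tau) -> (size (syl_word tau) <= size u + k.+2)%N ->
    exists w z, [/\ is_prefix_of L w, prefix u w,
     (size w <= size u + k.+2)%N, escaping z & infix (left_word Y z) w].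
  move=> altt t2 todd tfac tau_a ut st.
  exists (syl_word tau), z; split=> //; last exact: infix_syl_word za.
  exists (fgred (syl_word tau)); first exact: low (syllables_fgred altt) t2 todd tfac.
  by rewrite fgredK ?prefix_refl//; exact: reduced_syl_word.
have [od|ev] := boolP (odd (size (rcons sigma (inl a : syllable X Y)))); last first.
  apply: (fin (rcons sigma (inl a))) => //.
    by move: ev; rewrite size_rcons; case: (size sigma) => [|[]].
  by apply: leq_trans su _; rewrite leq_add2l.
have [b [_ sb DBb b0]] := hB 1%g.
apply: (fin (rcons (rcons sigma (inl a)) (inr b))).
- by apply: alternating_rcons => //; exact: nontrivial_inr.
- by rewrite !size_rcons.
- by rewrite size_rcons /= od.
- by move=> p; rewrite mem_rcons inE => /predU1P[->|/fac].
- by rewrite mem_rcons inE ina orbT.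
- by rewrite syl_word_rcons prefix_catl.
- rewrite size_syl_word_rcons size_syl_val; move: su.
  have : (size b <= 1)%N by [].
  lia.
Qed.

(** Serves the reduced forms when [C] is the whole second factor: a form is then a single syllable
    of the first. *)
Lemma recurrent_single (DA : set (freegroup X))
    (L : set (freegroup (X + Y)%type)) :
  (forall f, L f -> exists2 sigma, syllables f sigma &
     forall p, p \in sigma -> in_factor DA set0 p) ->
  (forall f a, syllables f [:: inl a] -> DA a -> L f) ->
  (forall z g, escaping z -> infix z (fgword g) -> DA g) ->
  prefix_recurrent R L.
Proof.
move=> up low hA; apply: (@prefix_recurrent_of_escape _ k) => u Lu.
suff [a [z [alt escz za ua su]]] : exists a z,
    [/\ alternating [:: inl a : syllable X Y], escaping z, infix z (fgword a),
        prefix u (syl_word [:: inl a : syllable X Y]) &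
        (size (syl_word [:: inl a : syllable X Y]) <= size u + k)%N].
  exists (syl_word [:: inl a : syllable X Y]), z; split=> //.
    exists (fgred (syl_word [:: inl a : syllable X Y])).
      apply: low; [exact: syllables_fgred|exact: hA za].
    by rewrite fgredK ?prefix_refl//; exact: reduced_syl_word.
  by apply: infix_syl_word za; exact: mem_head.
have [->|u0] := eqVneq u [::].
  have [a [z [nta escz za ak]]] := left_letters.
  exists a, z; split=> //; first exact: alternating1.
    exact: prefix0s.
  by rewrite -[[:: _]]/(rcons [::] _) size_syl_word_rcons size_syl_val /=; lia.
have [s1 [p [q [s2 [fac altp qp alt ->]]]]] := is_prefix_of_syllables up Lu u0.
have pl : is_inl p.
  by have := fac p; rewrite mem_cat mem_head orbT => /(_ isT); case: (p).
have s10 : s1 = [::].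
  case/lastP: s1 fac altp {alt} => // s1 r fac [alt _].
  have rl : is_inl r.
    by have := fac r; rewrite mem_cat mem_rcons mem_head => /(_ isT); case: (r).
  move: alt; case: s1 {fac} => [|r' s1]; rewrite /= ?rcons_path ?last_rcons.
    by rewrite rl pl.
  by rewrite rl pl andbF.
rewrite {}s10 in alt *; case: q qp alt => [a|b] qp alt; last by case: p pl qp {fac altp}.
have [b [z [altb escz zb bE zk]]] := left_extension alt.
exists b, z; split=> //.
  by apply: (@syl_word_rcons_prefix [::]); rewrite /= bE prefix_prefix.
rewrite -[[:: inl b]]/(rcons [::] _) !size_syl_word_rcons !size_syl_val bE size_cat.
by rewrite addnA leq_add2l.
Qed.

Lemma recurrent_canonical (S : set (freegroup X)) (T : set (freegroup Y))
    (L : set (freegroup (X + Y)%type)) s0 z0 n :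
  (forall f, L f -> exists2 sigma, syllables f sigma &
     forall p, p \in behead sigma -> in_factor S T p) ->
  (forall f sigma, syllables f sigma ->
     (forall p, p \in behead sigma -> in_factor S T p) -> L f) ->
  (forall s u : freegroup X, S s -> prefix u s -> S u) ->
  (forall t u : freegroup Y, T t -> prefix u t -> T u) ->
  (forall s d, S s -> ~ is_prefix_of C s -> reduced (fgword s ++ d) ->
     S (fgred (fgword s ++ d))) ->
  (forall s, S s -> is_prefix_of C s -> (size s <= n)%N) ->
  S s0 -> escaping z0 -> infix z0 (fgword s0) ->
  prefix_recurrent R L.
Proof.
move=> up low preS preT extS bndS Ss0 escz0 zs0.
have nts0 : nontrivial (inl s0 : syllable X Y).
  apply: nontrivial_inl; apply: contraTneq zs0 => ->; rewrite infixs0.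
  by case: escz0.
have fin tau a z : alternating tau -> (forall p, p \in behead tau -> in_factor S T p) ->
    inl a \in tau -> infix z (fgword a) -> escaping z ->
    is_prefix_of L (syl_word tau) /\ ~ is_prefix_of R (syl_word tau).
  move=> alt fac ina za escz; split.
    exists (fgred (syl_word tau)); first exact: low (syllables_fgred alt) fac.
    by rewrite fgredK ?prefix_refl//; exact: reduced_syl_word.
  by apply: (escaping_not_prefix escz); exact: infix_syl_word za.
(* The first [n.+1] steps take the walk past [u] by more than the length of any representative that
   is still a prefix of [C]. The rest pays for [s0] or for an escaping word. *)
exists (n.+1 + (size s0 + k))%N => u v Lv uv sv.
suff [tau [a [z [alt fac ina za [escz ut st]]]]] : exists tau a z,
    [/\ alternating tau, forall p, p \in behead tau -> in_factor S T p,
        inl a \in tau, infix z (fgword a) &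
        [/\ escaping z, prefix u (syl_word tau) &
        (size (syl_word tau) <= size u + (n.+1 + (size s0 + k)))%N]].
  have [Lt Rt] := fin tau a z alt fac ina za escz.
  by exists (syl_word tau).
have {v Lv uv sv}[v [Lv uv sv]] : exists v,
    [/\ is_prefix_of L v, prefix u v & size v = (size u + n.+1)%N].
  exists (take (size u + n.+1) v); split.
  - exact: is_prefix_of_prefix (prefix_take _ _) Lv.
  - case/prefixP: uv => s ->; rewrite take_cat ltnNge leq_addr /=.
    exact: prefix_prefix.
  - by rewrite size_take sv; case: ltnP => //; lia.
have v0 : v != [::] by rewrite -size_eq0 sv addnS.
have [s1 [p [q [s2 [fac altp qp alt vE]]]]] := is_prefix_of_syllables up Lv v0.
have fac1 r : r \in behead s1 -> in_factor S T r.
  by move=> rs; apply: fac; case: (s1) rs => //= ? ?; rewrite mem_cat => ->.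
have facp : s1 != [::] -> in_factor S T p.
  by move=> s10; apply: fac; case: (s1) s10 => //= ? ? _; rewrite mem_cat mem_head orbT.
have fac2 r : in_factor S T r ->
    forall r', r' \in behead (rcons s1 r) -> in_factor S T r'.
  move=> Fr r'; case: (s1) fac1 => //= ? l fac1.
  by rewrite mem_rcons inE => /predU1P[->|/fac1].
case: q qp alt vE => [a|b] qp alt vE; last first.
  exists (rcons (rcons s1 (inr b)) (inl s0)), s0, z0; split=> //.
  - exact: alternating_rcons.
  - have [->|s10] := eqVneq s1 [::]; first by move=> r; rewrite /= inE => /eqP ->.
    have Tb : T b by move: (facp s10) qp; case: (p) => // b' Tb' /(preT _ _ Tb').
    move=> r; case: (s1) s10 (fac2 (inr b) Tb) => //= ? l _ Fb.
    by rewrite mem_rcons inE => /predU1P[->|/Fb].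
  - by rewrite mem_rcons mem_head.
  - split=> //; first by rewrite syl_word_rcons prefix_catl// -vE.
    by rewrite size_syl_word_rcons -vE sv size_syl_val; lia.
have ext b z : alternating (rcons s1 (inl b : syllable X Y)) -> escaping z ->
    infix z (fgword b) -> fgword b = a ++ z -> (size z <= k)%N ->
    (forall p, p \in behead (rcons s1 (inl b)) -> in_factor S T p) ->
    exists tau a z,
    [/\ alternating tau, forall p, p \in behead tau -> in_factor S T p,
        inl a \in tau, infix z (fgword a) &
        [/\ escaping z, prefix u (syl_word tau) &
        (size (syl_word tau) <= size u + (n.+1 + (size s0 + k)))%N]].
  move=> altb escz zb bE zk facb.
  exists (rcons s1 (inl b)), b, z; split=> //; first by rewrite mem_rcons mem_head.
  split=> //.
    apply: prefix_trans uv _; rewrite vE; apply: syl_word_rcons_prefix.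
    by rewrite /= bE prefix_prefix.
  have := sv; rewrite vE !size_syl_word_rcons !size_syl_val bE size_cat; lia.
(* The first syllable of a canonical form is arbitrary, so it can be prolonged freely. *)
have [s10|s10] := eqVneq s1 [::].
  have [b [z [altb escz zb bE zk]]] := left_extension alt.
  by apply: ext altb escz zb bE zk _; rewrite s10.
have Sa : S a by move: (facp s10) qp; case: (p) => // a' Sa' /(preS _ _ Sa').
have [Pa|nPa] := pselect (is_prefix_of C a); last first.
  have [b [z [altb escz zb bE zk]]] := left_extension alt.
  apply: (ext b z) => //; apply: fac2 => /=.
  by rewrite -(fgwordK b) bE; apply: extS => //; rewrite -bE fgword_reduced.
(* As [a] has at most [n] letters, [u] ends before [a] begins, and [a] may be exchanged for [s0]. *)
have an := bndS _ Sa Pa.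
exists (rcons s1 (inl s0)), s0, z0; split=> //.
- exact: alternating_last alt _ _.
- exact: fac2.
- by rewrite mem_rcons mem_head.
have sv' : (size u <= size (syl_word s1))%N.
  by have := sv; rewrite vE size_syl_word_rcons size_syl_val; lia.
split=> //.
  rewrite syl_word_rcons; apply: prefix_catl; move: uv.
  by rewrite vE syl_word_rcons !prefixE takel_cat.
by have := sv; rewrite vE !size_syl_word_rcons !size_syl_val; lia.
Qed.

End LeftRecurrent.

(** * Common treatment of the four kinds of normal forms *)

Definition nf_upper (X Y : choiceType) (CA S : set (freegroup X))
    (CB T : set (freegroup Y)) (k : nf_kind) (sigma : seq (syllable X Y)) : Prop :=
  match k with
  | EF => True
  | RF => forall p, p \in sigma -> in_factor (~` CA) (~` CB) p
  | CNF => forall p, p \in behead sigma -> in_factor S T p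
  | CRF => (forall p, p \in sigma -> in_factor (~` CA) (~` CB) p) \/ (size sigma <= 1)%N
  end.

Definition nf_lower (X Y : choiceType) (CA S : set (freegroup X))
    (CB T : set (freegroup Y)) (k : nf_kind) (sigma : seq (syllable X Y)) : Prop :=
  match k with
  | EF => True
  | RF => sigma != [::] /\ forall p, p \in sigma -> in_factor (~` CA) (~` CB) p
  | CNF => forall p, p \in behead sigma -> in_factor S T p
  | CRF => [/\ (2 <= size sigma)%N, ~~ odd (size sigma) &
              forall p, p \in sigma -> in_factor (~` CA) (~` CB) p]
  end.

(** The upper bound governs the words that the walk may reach, the lower bound those into which they
    are prolonged; for [CRF] the latter have a positive even number of syllables. Both are symmetric
    in the factors, whereas [conj_into_C] names the first. *)
Definition nf_between (X Y : choiceType) (CA S : set (freegroup X))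
    (CB T : set (freegroup Y)) (k : nf_kind) (L : set (freegroup (X + Y)%type)) :=
  (forall f, L f -> exists2 sigma, syllables f sigma & nf_upper CA S CB T k sigma) /\
  (forall f sigma, syllables f sigma -> nf_lower CA S CB T k sigma -> L f).

(** For [g] in [C], append a letter outside [C]. If it cancels against the end of [g], its inverse,
    also outside [C], does not. *)
Lemma leave_subgroup (X : choiceType) (C : set (freegroup X)) (g : freegroup X) :
  subgroup C -> C <> setT -> exists h : freegroup X,
    [/\ prefix g h, (size h <= (size g).+1)%N, (~` C) h & fgword h != [::]].
Proof.
move=> Csub CT.
have nt h : ~ C h -> fgword h != [::].
  move=> nCh; apply/eqP => h0; apply: nCh.
  have -> : h = 1%g by apply: val_inj.
  exact: subgroup1.
have [Cg|nCg] := pselect (C g); last first.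
  by exists g; rewrite prefix_refl leqnSn; split=> //; exact: nt.
have [l nCl] : exists l, ~ C (fgred [:: l]).
  apply: contrapT => all; apply: CT; apply/seteqP; split=> // h _.
  rewrite -(fgwordK h); elim: (fgword h) => [|l w IH].
    by rewrite fgred_nil; exact: subgroup1.
  rewrite -cat1s fgred_cat; apply: subgroupM => //.
  by apply: contrapT => nl; apply: all; exists l.
have [m nCm rgm] : exists2 m, ~ C (fgred [:: m]) & reduced (g ++ [:: m]).
  have red m : m != linv (last l g) -> reduced (g ++ [:: m]).
    move=> ml; have [->//|g0] := eqVneq (fgword g) [::].
    by apply: (@reduced_cat_last _ _ _ l); rewrite ?fgword_reduced.
  have [ll|ll] := eqVneq l (linv (last l g)); last by exists l => //; exact: red.
  exists (linv l).
    move=> Cl; apply: nCl; rewrite -[fgred _]invgK; apply: (subgroupV Csub).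
    by rewrite -fgred_inv.
  by apply: red; rewrite {1}ll linvK; exact: linv_neq.
exists (fgred (g ++ [:: m])); have nC : ~ C (fgred (g ++ [:: m])).
  rewrite fgred_cat fgwordK => Cgm; apply: nCm.
  by rewrite -(mulKg g (fgred _)); apply: subgroupM => //; exact: subgroupV.
split=> //; last exact: nt.
  by rewrite fgredK// prefix_prefix.
by rewrite fgredK// size_cat addn1.
Qed.

Lemma subgroup_trivial (X : choiceType) : subgroup [set 1%g : freegroup X].
Proof. by split=> // _ _ -> ->; rewrite /= mulgV. Qed.

Lemma left_recurrent (X Y : finType) (CA S : set (freegroup X))
    (CB T : set (freegroup Y)) (k : nf_kind) (L R : set (freegroup (X + Y)%type)) :
  subgroup CA -> infinite_index CA -> CA <> [set 1%g] -> finite_core CA ->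
  schreier_transversal CA S ->
  subgroup CB -> CB <> [set 1%g] -> schreier_transversal CB T ->
  (k = CRF -> CB <> setT) ->
  nf_between CA S CB T k L ->
  (forall f, R f -> exists2 sigma, syllables f sigma &
     forall a, inl a \in sigma -> bad_syllable CA a) ->
  prefix_recurrent R L.
Proof.
move=> CAsub inf CA1 core trS CBsub CB1 trT crf [up low] Rbad.
have [m escw] := escape_word CAsub inf CA1 core.
have esc (u : seq (letter X)) : reduced u -> exists z,
    [/\ reduced (u ++ z), (size z <= m)%N & escaping CA z].
  by move=> /escw[z [ruz z0 zm zbad]]; exists z; split.
have hA z g : escaping CA z -> infix z (fgword g) -> (~` CA) g.
  by move=> [_ zbad] /zbad; apply: contra_not; exact: subgroup_bad.
case: k crf up low => crf up low.
(* Freely reduced forms are treated as reduced forms over the trivial subgroup. *)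
- apply: (recurrent_even Rbad esc (DA := ~` [set 1%g]) (DB := ~` [set 1%g])).
  + move=> f /up[sigma syl _]; exists sigma => //; left.
    have [[_ nt] _] := (syllablesE _ _).1 syl.
    by case=> [a|b] /nt[na nb] E; [exact: na (congr1 inl E)|exact: nb (congr1 inr E)].
  + by move=> f sigma syl _ _ _; exact: low syl _.
  + by move=> z g [z0 _] zg gE; move: zg z0; rewrite gE infixs0 => ->.
  + move=> b; apply: leave_subgroup; first exact: subgroup_trivial.
    move=> b1; apply: CB1; apply/seteqP; split=> [c _|_ ->]; last exact: subgroup1.
    by rewrite b1.
- have [CBT|CBT] := pselect (CB = setT).
    apply: (recurrent_single Rbad esc (DA := ~` CA)).
    + move=> f /up[sigma syl fac]; exists sigma => // p /fac.
      by case: p => [a|b] /=; [|rewrite CBT => nb; case: (nb I)].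
    + move=> f a syl nCa; apply: low syl _; split=> //.
      by move=> p; rewrite inE => /eqP ->.
    + exact: hA.
  apply: (recurrent_even Rbad esc (DA := ~` CA) (DB := ~` CB)).
  + by move=> f /up[sigma syl fac]; exists sigma => //; left.
  + move=> f sigma syl s2 _ fac; apply: low syl _; split=> //.
    by rewrite -size_eq0; case: (size _) s2.
  + exact: hA.
  + by move=> b; exact: leave_subgroup.
- have [uS _ preS] := trS; have [_ _ preT] := trT.
  have [qs qsP] := core.
  have [n bnd] := transversal_prefix_bounded CAsub qsP trS.
  have [s Ss nPs] := transversal_not_prefix CAsub qsP inf trS.
  have [z [rsz zm escz]] := esc s (fgword_reduced s).
  apply: (recurrent_canonical Rbad esc up low preS preT _ bnd
    (transversal_extend CAsub trS Ss nPs rsz) escz).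
    by move=> s' d; exact: transversal_extend.
  by rewrite fgredK// suffix_infix.
- apply: (recurrent_even Rbad esc up _ hA).
    by move=> f sigma syl s2 ev fac; apply: low syl _.
  by move=> b; apply: leave_subgroup => //; exact: crf.
Qed.

(** * Exchanging the two factors *)

Section Swap.
Variables X Y : choiceType.

Definition sum_swap (A B : Type) (x : A + B) : B + A :=
  match x with inl a => inr a | inr b => inl b end.

Lemma sum_swapK (A B : Type) : cancel (@sum_swap A B) (@sum_swap B A).
Proof. by case. Qed.

Definition word_swap (A B : Type) (w : seq (letter (A + B)%type)) :
    seq (letter (B + A)%type) :=
  [seq (sum_swap l.1, l.2) | l <- w].

Lemma word_swapK (A B : Type) : cancel (@word_swap A B) (@word_swap B A).
Proof.
move=> w; rewrite /word_swap -map_comp -[RHS]map_id; apply: eq_map => -[x b] /=.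
by rewrite sum_swapK.
Qed.

Definition fgswap (f : freegroup (X + Y)%type) : freegroup (Y + X)%type :=
  FreeGroup (map_reduced (can_inj (@sum_swapK X Y)) (fgword_reduced f)).

Lemma prefix_swap (u v : seq (letter (X + Y)%type)) :
  prefix (word_swap u) (word_swap v) = prefix u v.
Proof.
rewrite !prefixE /word_swap size_map -map_take; apply: inj_eq.
by apply/can_inj/word_swapK.
Qed.

Lemma is_prefix_of_swap (L : set (freegroup (X + Y)%type)) u :
  is_prefix_of (fgswap @` L) (word_swap u) <-> is_prefix_of L u.
Proof.
split=> [[_ [f Lf <-]]|[f Lf uf]]; first by rewrite (prefix_swap u f); exists f.
by exists (fgswap f); [exists f|rewrite (prefix_swap u f)].
Qed.

(** Recurrence speaks of prefixes alone, so exchanging the factors at this level avoids transporting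
    the measure. *)
Lemma prefix_recurrent_swap (R L : set (freegroup (X + Y)%type)) :
  prefix_recurrent (fgswap @` R) (fgswap @` L) -> prefix_recurrent R L.
Proof.
case=> k rec; exists k => u v Lv uv sv.
have [||| w [Lw uw sw Rw]] := rec (word_swap u) (word_swap v).
- exact/is_prefix_of_swap.
- by rewrite prefix_swap.
- by rewrite !size_map.
rewrite -(word_swapK w) in Lw uw sw Rw.
exists (word_swap w); split.
- exact/is_prefix_of_swap.
- by rewrite -prefix_swap.
- by move: sw; rewrite !size_map.
- by move=> Rw'; apply: Rw; apply/is_prefix_of_swap.
Qed.

Lemma syllables_swap f (sigma : seq (syllable X Y)) :
  syllables f sigma -> syllables (fgswap f) (map (@sum_swap _ _) sigma).
Proof.
move=> /syllablesE[[alt nt] fE]; apply/syllablesE; split; first split.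
- rewrite sorted_map; apply: sub_sorted alt => -[a|b] [c|d] //.
- move=> _ /mapP[p /nt[p1 p2] ->]; case: p p1 p2 => a p1 p2.
    by split=> // -[aE]; apply: p1; rewrite aE.
  by split=> // -[aE]; apply: p2; rewrite aE.
- rewrite [LHS]/= fE /syl_word map_flatten -!map_comp.
  by congr flatten; apply: eq_map => -[a|b] /=; rewrite -map_comp.
Qed.

End Swap.

Lemma nf_between_swap (X Y : choiceType) (CA S : set (freegroup X))
    (CB T : set (freegroup Y)) (k : nf_kind) (L : set (freegroup (X + Y)%type)) :
  nf_between CA S CB T k L -> nf_between CB T CA S k (@fgswap X Y @` L).
Proof.
have in_swap (A B : choiceType) (P : set (freegroup A)) (Q : set (freegroup B))
    (sigma : seq (syllable A B)) : (forall p, p \in sigma -> in_factor P Q p) ->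
    forall p, p \in map (@sum_swap _ _) sigma -> in_factor Q P p.
  by move=> H _ /mapP[p /H Hp ->]; case: p Hp.
case=> up low; split=> [_ [f /up[sigma syl us] <-]|f sigma syl ls].
  exists (map (@sum_swap _ _) sigma); first exact: syllables_swap.
  case: k us {up low} => //=.
  - exact: in_swap.
  - by rewrite behead_map; exact: in_swap.
  - by rewrite size_map => -[us|]; [left; exact: in_swap|right].
exists (fgswap f); last first.
  by apply: val_inj; exact: (@word_swapK Y X).
apply: low (syllables_swap syl) _.
case: k ls {up} => //=.
- by move=> [s0 ls]; split; [case: (sigma) s0|exact: in_swap].
- by rewrite behead_map; exact: in_swap.
- by rewrite size_map => -[? ? ls]; split=> //; exact: in_swap.
Qed.

Lemma normal_form_recurrent (X Y : finType) (CA S : set (freegroup X))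
    (CB T : set (freegroup Y)) (k : nf_kind) (L R : set (freegroup (X + Y)%type)) :
  subgroup CA -> CA <> [set 1%g] -> finite_core CA -> schreier_transversal CA S ->
  subgroup CB -> CB <> [set 1%g] -> finite_core CB -> schreier_transversal CB T ->
  infinite_index CA \/ infinite_index CB ->
  (k = CRF -> CA <> setT /\ CB <> setT) ->
  nf_between CA S CB T k L ->
  (forall f, R f -> exists2 sigma, syllables f sigma &
     forall p, p \in sigma -> in_factor (bad_syllable CA) (bad_syllable CB) p) ->
  prefix_recurrent R L.
Proof.
move=> A1 A2 A3 A4 B1 B2 B3 B4 inf crf nfL Rbad; case: inf => inf.
  apply: (left_recurrent A1 inf A2 A3 A4 B1 B2 B4 _ nfL).
    by move=> /crf[].
  move=> f /Rbad[sigma syl bad]; exists sigma => // a /bad; exact.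
apply: prefix_recurrent_swap.
apply: (left_recurrent B1 inf B2 B3 B4 A1 A2 A4 _ (nf_between_swap nfL)).
  by move=> /crf[].
move=> _ [f /Rbad[sigma syl bad] <-]; exists (map (@sum_swap _ _) sigma).
  exact: syllables_swap.
by move=> b /mapP[[//|b'] /bad bad' [->]].
Qed.

(** * From bad syllables to unstable and singular forms *)

Lemma syllables1 (X Y : choiceType) (sigma : seq (syllable X Y)) :
  syllables 1%g sigma -> sigma = [::].
Proof.
case: sigma => // p sigma /syllablesE[alt].
have := syl_val_nil (alternating_nontrivial alt).
by rewrite /syl_word /=; case: (fgword _).
Qed.

Lemma syllables_syl_val (X Y : choiceType) (p : syllable X Y) :
  exists2 sigma, syllables (syl_val p) sigma & (size sigma <= 1)%N.
Proof.
have [nt|triv] := pselect (nontrivial p).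
  exists [:: p] => //; apply/syllablesE; split; first exact: alternating1.
  by rewrite /syl_word /= cats0.
exists [::] => //; apply/syllablesE; split=> //.
by move/not_andP: triv => -[] /contrapT ->.
Qed.

Lemma by_rep_bad (X : choiceType) (C S P : set (freegroup X)) a :
  subgroup C -> schreier_transversal C S ->
  (forall s, S s -> ~ P s -> bad_syllable C s) -> ~ by_rep C S P a -> bad_syllable C a.
Proof.
move=> Csub [uS _ _] bad nPa; have [s [[Ss Csa] _]] := uS a.
have := bad s Ss (fun Ps => nPa (ex_intro _ s (And3 Ss Csa Ps))).
by case: Csa => c Cc <-; exact: bad_syllable_mul.
Qed.

Lemma nf_set_between (X Y Z : finType)
    (phi : {multiplicative freegroup Z -> freegroup X})
    (psi : {multiplicative freegroup Z -> freegroup Y}) S T k :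
  nf_between (range phi) S (range psi) T k (nf_set phi psi S T k).
Proof.
have C1 : range phi 1%g by exists 1%g => //; exact: multiplicative1.
have D1 : range psi 1%g by exists 1%g => //; exact: multiplicative1.
split=> [f|f sigma syl]; case: k => /=.
- by case=> sigma [syl _ _]; exists sigma.
- by case=> sigma [syl fac _]; exists sigma.
- by case=> sigma [syl fac]; exists sigma.
- case=> [[[[sigma [syl fac _]] _]|[[p _ <-] _]]|[c [->|->]]].
  + by exists sigma => //; left.
  + by have [sigma syl s1] := syllables_syl_val p; exists sigma => //; right.
  + have [sigma syl s1] := @syllables_syl_val X Y (inl (phi c)).
    by exists sigma => //; right.
  + have [sigma syl s1] := @syllables_syl_val X Y (inr (psi c)).
    by exists sigma => //; right.
- by move=> _; exists sigma; split=> //; [case|left].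
- move=> [s0 fac]; exists sigma; split=> // f1; rewrite f1 in syl.
  by rewrite (syllables1 syl) in s0.
- by move=> fac; exists sigma; split.
- move=> [s2 ev fac]; left; left; split; exists sigma; split=> // f1.
  by rewrite f1 in syl; rewrite (syllables1 syl) in s2.
Qed.

Section NormalForms.
Variables (K : realType) (X Y Z : finType).
Variables (phi : {multiplicative freegroup Z -> freegroup X})
  (psi : {multiplicative freegroup Z -> freegroup Y}).
Hypotheses (phi_inj : injective phi) (psi_inj : injective psi).
Variables (S : set (freegroup X)) (T : set (freegroup Y)).
Hypothesis S_transversal : schreier_transversal (range phi) S.
Hypothesis T_transversal : schreier_transversal (range psi) T.
Variable k : nf_kind.
Hypothesis C_infinite_index : infinite_index (range phi) \/ infinite_index (range psi).
Hypothesis C_proper : k = CRF -> (0 < #|Z|)%N ->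
  range phi <> [set: freegroup X] /\ range psi <> [set: freegroup Y].
Variables (P : set (freegroup X)) (Q : set (freegroup Y)).
Hypothesis P_bad : forall s, S s -> ~ P s -> bad_syllable (range phi) s.
Hypothesis Q_bad : forall t, T t -> ~ Q t -> bad_syllable (range psi) t.
Hypothesis P_trivial : range phi = [set 1%g] -> S `<=` P.
Hypothesis Q_trivial : range psi = [set 1%g] -> T `<=` Q.

(** [P] and [Q] stand for stability or for regularity of representatives: their failure makes a
    representative bad, and they hold throughout over a trivial [C]. *)
Lemma nf_without_exp_measurable : let NF := nf_set phi psi S T k in
  exp_measurable K
    (NF `\` some_syllable (by_rep (range phi) S P) (by_rep (range psi) T Q)) NF.
Proof.
move=> NF; set R := _ `\` _.
have nfL := nf_set_between phi psi S T k.
(* Over a trivial [C] only the empty form can lack a stable (regular) syllable, so the frequencies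
   vanish from radius 1 on and any [q] between 0 and 1 will do. *)
have [Z0|Z0] := posnP #|Z|.
  have Z1 (g : freegroup Z) : g = 1%g.
    apply: val_inj => /=; case: (fgword g) => //= -[z b] w.
    by have := card0_eq Z0 z.
  have phi1 : range phi = [set 1%g].
    apply/seteqP; split=> [_ [g _ <-]|_ ->]; last first.
      by exists 1%g => //; exact: multiplicative1.
    by rewrite (Z1 g) /=; exact: multiplicative1.
  have psi1 : range psi = [set 1%g].
    apply/seteqP; split=> [_ [g _ <-]|_ ->]; last first.
      by exists 1%g => //; exact: multiplicative1.
    by rewrite (Z1 g) /=; exact: multiplicative1.
  have sub : R `<=` @sphere _ 0.
    move=> f [NFf nf].
    have [sigma syl _] := nfL.1 f NFf.
    case: sigma syl => [/syllablesE[_ fE]|p sigma syl]; first by rewrite /sphere /= fE.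
    case: nf; exists (p :: sigma); split=> //; exists p; split; first exact: mem_head.
    case: p {syl} => [a|b] /=.
      have [uS _ _] := S_transversal; have [s [[Ss Cs] _]] := uS a.
      by exists s; split=> //; exact: P_trivial.
    have [uT _ _] := T_transversal; have [t [[Tt Ct] _]] := uT b.
    by exists t; split=> //; exact: Q_trivial.
  exists (2%:R^-1)%R; split; [by rewrite invr_gt0|by rewrite invf_lt1// ltr1n|].
  exists 1%N => n n0; rewrite /frequency; have -> : R `&` @sphere _ n = set0.
    apply/seteqP; split=> // f [/sub f0 fn]; move: n0.
    by rewrite -fn; move: f0; rewrite /sphere /= => ->.
  by rewrite fsbig_set0 exprn_ge0// invr_ge0.
apply: prefix_recurrent_exp_measurable.
have nontriv (A : finType) (th : {multiplicative freegroup Z -> freegroup A}) :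
    injective th -> range th <> [set 1%g].
  move=> th_inj th1; have [z _] := card_gt0P Z0.
  have : [set 1%g] (th (fgred [:: (z, true)])).
    by rewrite -th1; exists (fgred [:: (z, true)]).
  rewrite /= -(multiplicative1 th) => /th_inj/(congr1 (@fgword Z)).
  by [].
apply: (normal_form_recurrent (range_subgroup phi) (nontriv _ phi phi_inj)
  (range_finite_core phi) S_transversal (range_subgroup psi) (nontriv _ psi psi_inj)
  (range_finite_core psi) T_transversal C_infinite_index _ nfL).
  by move=> /C_proper/(_ Z0).
move=> f [NFf nf]; have [sigma syl _] := nfL.1 f NFf; exists sigma => // p ps.
case: p ps => [a|b] ps /=.
  apply: (by_rep_bad (range_subgroup phi) S_transversal P_bad) => Pa.
  by apply: nf; exists sigma; split=> //; exists (inl a).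
apply: (by_rep_bad (range_subgroup psi) T_transversal Q_bad) => Qb.
by apply: nf; exists sigma; split=> //; exists (inr b).
Qed.

End NormalForms.

Lemma trivial_regular_rep (X : choiceType) (s : freegroup X) :
  regular_rep [set 1%g] s.
Proof.
apply; apply/seteqP; split=> [_ []//|_ ->]; split=> //.
by exists 1%g; rewrite ?conj1g.
Qed.

(** [C_proper] excludes a degenerate case of [CRF]. If [C] is nontrivial and [psi], say, is onto,
    all of F(Y) belongs to [CRF] as an image of [C] and consists of singular, unstable forms. No
    form has two syllables, so a walk that starts with a letter of [Y] never leaves them, and the
    frequencies do not tend to 0. *)
Theorem theoremB (K : realType) (X Y Z : finType)
    (phi : {multiplicative freegroup Z -> freegroup X})
    (psi : {multiplicative freegroup Z -> freegroup Y})
    (phi_inj : injective phi) (psi_inj : injective psi)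
    (S : set (freegroup X)) (T : set (freegroup Y))
    (S_transversal : schreier_transversal (range phi) S)
    (T_transversal : schreier_transversal (range psi) T)
    (k : nf_kind)
    (C_infinite_index :
      infinite_index (range phi) \/ infinite_index (range psi))
    (C_proper : k = CRF -> (0 < #|Z|)%N ->
      range phi <> [set: freegroup X] /\ range psi <> [set: freegroup Y]) :
  let NF := nf_set phi psi S T k in
  exp_measurable K (unstable_forms (range phi) S (range psi) T NF) NF /\
  exp_measurable K (singular_forms (range phi) S (range psi) T NF) NF.
Proof.
move=> NF; split.
  apply: (nf_without_exp_measurable K phi_inj psi_inj S_transversal T_transversal
    C_infinite_index C_proper).
  - by move=> s; exact: (unstable_rep_bad (range_subgroup phi) S_transversal).
  - by move=> t; exact: (unstable_rep_bad (range_subgroup psi) T_transversal).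
  - by move=> -> s Ss c ->; rewrite mulg1.
  - by move=> -> t Tt c ->; rewrite mulg1.
apply: (nf_without_exp_measurable K phi_inj psi_inj S_transversal T_transversal
  C_infinite_index C_proper).
- by move=> s _ /contrapT ns; apply: (nstar_bad (range_subgroup phi)).
- by move=> t _ /contrapT nt; apply: (nstar_bad (range_subgroup psi)).
- by move=> -> s _; exact: trivial_regular_rep.
- by move=> -> t _; exact: trivial_regular_rep.
Qed.
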